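(* There exist absolute constants $c,c'>0$ such that the following holds. Let $n\ge 4$ be an integer, and suppose that $w_1,\dots,w_5$ are weighted directed graphs on $[n]$ such that $w_i([n])=0$ and $\|w_i\|_1=n(n-1)$ for every $i\in\{1,\dots,5\}$. Then there exist distinct $i,j$ such that $$\operatorname{disc}^+(w_i,w_j)\,\operatorname{disc}^-(w_i,w_j)\ge c\,n^3.$$ In particular, there are $i<j$ such that $$\operatorname{disc}(w_i,w_j)\ge c'\,n^{3/2}.$$
   Context: Write $[n]=\{1,\dots,n\}$ and let $[n]^{(2)}=\{(x,y)\in[n]\times[n]:x\ne y\}$ be the set of ordered pairs of distinct vertices. A weighted directed graph on $[n]$ is a function $w:[n]^{(2)}\to\mathbb R$, with values written $w_{xy}$. For weighted directed graphs $w,u$ on $[n]$ put $\langle w,u\rangle=\sum_{x\ne y}w_{xy}u_{xy}$, $\|w\|_1=\sum_{x\ne y}|w_{xy}|$, $w([n])=\sum_{x\ne y}w_{xy}$ (sums over ordered pairs of distinct vertices), and $d(w)=w([n])/(n(n-1))$. For a permutation $\pi\in S_n$ the relabelling $w_\pi$ is $(w_\pi)_{xy}=w_{\pi^{-1}(x)\pi^{-1}(y)}$. Define $$\operatorname{disc}^+(w,u)=\max_{\pi\in S_n}\langle w_\pi,u\rangle-d(w)d(u)n(n-1),\qquad \operatorname{disc}^-(w,u)=d(w)d(u)n(n-1)-\min_{\pi\in S_n}\langle w_\pi,u\rangle,$$ and $\operatorname{disc}(w,u)=\max\{\operatorname{disc}^+(w,u),\operatorname{disc}^-(w,u)\}$.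 *)

(* Defs.v *)
From HB Require Import structures.
From mathcomp Require Import all_boot all_order all_algebra all_fingroup.
From mathcomp Require Import reals exp.

Set Implicit Arguments.
Unset Strict Implicit.
Unset Printing Implicit Defensive.

Import Order.TTheory GRing.Theory Num.Theory.

Local Open Scope ring_scope.

(* The vertex set [n] is 'I_n.  Only the values w x y with x != y are
   meaningful: every definition below ignores the diagonal, so this encodes
   exactly the functions on ordered pairs of distinct vertices. *)
Definition wdigraph (R : realType) (n : nat) : Type := 'I_n -> 'I_n -> R.

Section WeightedDigraphs.
Variables (R : realType) (n : nat).
Implicit Types (w u : wdigraph R n) (pi : 'S_n).

Definition wd_inner w u : R :=
  \sum_(x < n) \sum_(y < n | x != y) w x y * u x y.

Definition wd_norm1 w : R := \sum_(x < n) \sum_(y < n | x != y) `|w x y|.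

Definition wd_total w : R := \sum_(x < n) \sum_(y < n | x != y) w x y.

Definition wd_density w : R := wd_total w / (n%:R * (n%:R - 1)).

Definition wd_relabel w pi : wdigraph R n :=
  fun x y => w ((pi^-1)%g x) ((pi^-1)%g y).

(* The default of the iterated max/min is the value at the identity
   permutation, so these are the true maximum and minimum over 'S_n. *)
Definition wd_max_inner w u : R :=
  \big[Num.max/wd_inner (wd_relabel w 1%g) u]_(pi : 'S_n)
    wd_inner (wd_relabel w pi) u.

Definition wd_min_inner w u : R :=
  \big[Num.min/wd_inner (wd_relabel w 1%g) u]_(pi : 'S_n)
    wd_inner (wd_relabel w pi) u.

Definition disc_plus w u : R :=
  wd_max_inner w u - wd_density w * wd_density u * (n%:R * (n%:R - 1)).

Definition disc_minus w u : R :=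
  wd_density w * wd_density u * (n%:R * (n%:R - 1)) - wd_min_inner w u.

Definition disc w u : R := Num.max (disc_plus w u) (disc_minus w u).

End WeightedDigraphs.

(* Main.v *)
Require Import Defs.
From mathcomp Require Import all_boot all_order all_algebra all_fingroup.
From mathcomp Require Import reals exp.
From mathcomp Require Import ring lra zify.
Import Order.TTheory GRing.Theory Num.Theory.
Local Open Scope ring_scope.

(** Let X(s,t) be the inner product of the relabellings of w and u by s and t, and -L and M
    its extreme values, so that M = disc^+ and L = disc^- when w has total 0.

    Product of the two discrepancies.  Take disjoint transpositions of positions acting on s, and
    functions phi_i with |phi_i| <= 1, odd under the i-th transposition and invariant under the
    others.  Each term of X sees two positions only, so the mean of X against the probability
    density prod_i (1 + t phi_i), |t| <= 1, is t A + t^2 B with A = sum_i E[X phi_i].  This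
    quadratic stays in [-L, M], which forces A^2 / 4 <= M L.  With about n/4 transpositions it
    is enough to find phi_i with E[X phi_i] >= c sqrt n.

    Choice of phi_i.  Swapping the positions p and q changes X by a sum over the other positions
    z of (w_pz - w_qz)(u_pz - u_qz) and its transpose.  Swapping positions r and r' in w
    randomizes the sign of a product of alternating sums over the 4-cycle p r q r'; by
    Khinchine's inequality the sum over n/4 pairs r, r' has size sqrt n times the product of the
    mean alternating sums, separately for the symmetric and for the antisymmetric parts.

    Otherwise w is close in norm to f(x) + g(y), because a function with vanishing degrees is
    bounded in mean by its alternating sums; then E[X phi_i] can be computed from the degree
    differences at p and q alone, as a nearly orthogonal bilinear form in two dimensions,
    and it has order n unless the two random planar vectors are almost orthogonal.  Three
    random planar vectors cannot be pairwise almost orthogonal.  Among five graphs, two have a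
    large symmetric part, or two have a large antisymmetric part, or three have neither. *)

Set Implicit Arguments.
Unset Strict Implicit.
Unset Printing Implicit Defensive.

(** * Means over finite types *)

Definition mean (R : realType) (T : finType) (F : T -> R) : R :=
  (\sum_(x : T) F x) / #|T|%:R.

Section Mean.
Variables (R : realType) (T : finType).
Implicit Types F G : T -> R.

Lemma eq_mean F G : F =1 G -> mean F = mean G.
Proof. by move=> e; rewrite /mean (eq_bigr G). Qed.

Lemma meanD F G : mean (fun x => F x + G x) = mean F + mean G.
Proof. by rewrite /mean big_split mulrDl. Qed.

Lemma meanZ c F : mean (fun x => c * F x) = c * mean F.
Proof. by rewrite /mean -mulr_sumr mulrA. Qed.

Lemma meanN F : mean (fun x => - F x) = - mean F.
Proof. by rewrite /mean sumrN mulNr. Qed.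

Lemma meanB F G : mean (fun x => F x - G x) = mean F - mean G.
Proof. by rewrite meanD meanN. Qed.

Lemma mean_sum (I : finType) (P : pred I) (F : I -> T -> R) :
  mean (fun x => \sum_(i | P i) F i x) = \sum_(i | P i) mean (F i).
Proof. by rewrite /mean exchange_big mulr_suml. Qed.

Lemma le_mean F G : (forall x, F x <= G x) -> mean F <= mean G.
Proof.
by move=> h; rewrite /mean ler_wpM2r ?invr_ge0 ?ler0n// ler_sum// => i _; apply: h.
Qed.

Lemma mean_ge0 F : (forall x, 0 <= F x) -> 0 <= mean F.
Proof. by move=> h; rewrite /mean divr_ge0 ?ler0n// sumr_ge0. Qed.

Lemma mean_cst (c : R) : (0 < #|T|)%N -> mean (fun _ : T => c) = c.
Proof.
move=> T0; rewrite /mean sumr_const -[c *+ _]mulr_natr mulfK//.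
by rewrite pnatr_eq0 -lt0n.
Qed.

Lemma mean_inj (h : T -> T) F :
  injective h -> mean (fun x => F (h x)) = mean F.
Proof. by move=> hi; rewrite /mean [in RHS](reindex_inj hi). Qed.

Lemma mean_odd (h : T -> T) F :
  injective h -> (forall x, F (h x) = - F x) -> mean F = 0.
Proof.
move=> hi hF; have := mean_inj F hi.
rewrite (@eq_mean _ (fun x => - F x))// meanN; lra.
Qed.

End Mean.

Lemma mean_pair (R : realType) (T U : finType) (F : T -> U -> R) :
  mean (fun x : T * U => F x.1 x.2) = mean (fun s => mean (F s)).
Proof.
rewrite /mean card_prod natrM invfM mulrA mulrAC; congr (_ * _).
by rewrite -pair_bigA/= mulr_suml.
Qed.

Lemma mean_prod (R : realType) (T U : finType) (F : T -> R) (G : U -> R) :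
  mean (fun x : T * U => F x.1 * G x.2) = mean F * mean G.
Proof.
rewrite (mean_pair (fun x y => F x * G y)) [RHS]mulrC -meanZ; apply: eq_mean => x.
by rewrite meanZ mulrC.
Qed.

Lemma mean_swap (R : realType) (T U : finType) (F : T -> U -> R) :
  mean (fun x : T * U => F x.1 x.2) = mean (fun x : U * T => F x.2 x.1).
Proof.
rewrite /mean !card_prod mulnC; congr (_ / _).
by rewrite (reindex (fun x : U * T => (x.2, x.1)))//; exists (fun x => (x.2, x.1)) => -[].
Qed.

(** * The product of the two discrepancies *)

(** If the vertex lies in [-1, 1], it forces one of [M], [L] to be at least A^2/(4|B|), an end of
    the interval forces the other to be at least |B|, and [B] cancels in the product. Otherwise |B|
    < A/2, and the two ends alone give A^2 - B^2. *)
Lemma quadratic_range (R : realType) (A B M L : R) : 0 <= A ->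
  (forall t, -1 <= t <= 1 -> - L <= t * A + t ^+ 2 * B <= M) ->
  A ^+ 2 / 4 <= M * L.
Proof.
move=> A0 H.
have /andP[H1 H1'] := H 1 ltac:(lra).
have /andP[H2 H2'] := H (-1) ltac:(lra).
have [AB|BA] := lerP A (2 * `|B|); last first.
  have : `|B| <= A / 2 by lra.
  by rewrite ler_norml => /andP[b1 b2]; nra.
have [B0|B0] := eqVneq B 0.
  have A00 : A = 0 by move: AB; rewrite B0 normr0; lra.
  by rewrite A00 in H1 *; nra.
have tb : -1 <= - A / (2 * B) <= 1.
  rewrite -ler_norml normrM normfV normrN normrM (ger0_norm A0) (@ger0_norm _ 2)//.
  by rewrite ler_pdivrMr ?mul1r// pmulr_rgt0 ?normr_gt0.
have /andP[] := H _ tb.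
have -> : - A / (2 * B) * A + (- A / (2 * B)) ^+ 2 * B = - (A ^+ 2 / 4) / B by field.
have [Bp|Bn] := ltrP 0 B => h1 h2.
  have : B * (A ^+ 2 / 4 / B) <= M * L.
    apply: ler_pM; [exact: ltW|by rewrite divr_ge0 ?(ltW Bp)//; nra|nra|lra].
  by rewrite mulrCA divff// mulr1.
have {}Bn : B < 0 by rewrite lt_neqAle B0.
have : (- (A ^+ 2 / 4) / B) * - B <= M * L.
  apply: ler_pM; [|by lra|lra|nra].
  by rewrite -mulrNN opprK -invrN divr_ge0 ?oppr_ge0 ?(ltW Bn)//; nra.
by rewrite mulrN -mulNr mulNr -mulrA mulVf// mulr1 opprK.
Qed.

Section Riesz.
Variables (R : realType) (T K : finType) (m : nat).
Variables (h : 'I_m -> T -> T) (phi : 'I_m -> T -> R) (X : K -> T -> R).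
Hypothesis T_gt0 : (0 < #|T|)%N.
Hypothesis h_inj : forall i, injective (h i).
Hypothesis phi_le1 : forall i x, `|phi i x| <= 1.
Hypothesis phi_odd : forall i x, phi i (h i x) = - phi i x.
Hypothesis phi_inv : forall i j x, i != j -> phi j (h i x) = phi j x.
Hypothesis X_local : forall k (I : {set 'I_m}), (2 < #|I|)%N ->
  exists2 i, i \in I & forall x, X k (h i x) = X k x.

Lemma prod_phi_odd (I : {set 'I_m}) i x : i \in I ->
  \prod_(j in I) phi j (h i x) = - \prod_(j in I) phi j x.
Proof.
move=> iI; rewrite (bigD1 i)//= [in RHS](bigD1 i)//= phi_odd mulNr; congr (- (_ * _)).
by apply: eq_bigr => j /andP[_ ji]; rewrite phi_inv// eq_sym.
Qed.

Let S x := \sum_k X k x.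

Lemma mean_prod_phi (I : {set 'I_m}) : I != set0 -> mean (fun x => \prod_(j in I) phi j x) = 0.
Proof.
by case/set0Pn => i iI; apply: (mean_odd (@h_inj i)) => x; rewrite prod_phi_odd.
Qed.

(** Each term of X is fixed by some flip under which the product of the [phi j] is odd. This removes
    all powers of t above the second. *)
Lemma mean_X_prod_phi (I : {set 'I_m}) : (2 < #|I|)%N ->
  mean (fun x => S x * \prod_(j in I) phi j x) = 0.
Proof.
move=> I2; rewrite /S.
under eq_mean do rewrite mulr_suml.
rewrite mean_sum big1// => k _.
have [i iI Xi] := X_local k I2.
by apply: (mean_odd (@h_inj i)) => x; rewrite prod_phi_odd// Xi mulrN.
Qed.

(* The mean of X against the Riesz product [prod_i (1 + t phi_i)], a probability
   density for |t| <= 1, is a polynomial of degree 2 in t with no constant term. *)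
Lemma riesz_product (M L : R) :
  mean S = 0 -> (forall x, - L <= S x <= M) ->
  0 <= \sum_i mean (fun x => S x * phi i x) ->
  (\sum_i mean (fun x => S x * phi i x)) ^+ 2 / 4 <= M * L.
Proof.
move=> S0 SML A0; set A := \sum_i _.
pose c (I : {set 'I_m}) := mean (fun x => S x * \prod_(j in I) phi j x).
apply: (@quadratic_range _ A (\sum_(I : {set 'I_m} | #|I| == 2%N) c I)) => // t t1.
have dens x : \prod_i (1 + t * phi i x) =
    \sum_(I : {set 'I_m}) t ^+ #|I| * \prod_(j in I) phi j x.
  rewrite (eq_bigr (fun i => t * phi i x + 1)) => [|i _]; last by rewrite addrC.
  rewrite bigA_distr/=; apply: eq_bigr => I _.
  by rewrite big_if/= [X in _ * X]big1// mulr1 big_split/= prodr_const.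
have dens_ge0 x : 0 <= \prod_i (1 + t * phi i x).
  apply: prodr_ge0 => i _; rewrite -lerBlDl sub0r.
  have : `|t * phi i x| <= 1.
    by rewrite normrM -[1]mulr1 ler_pM// ler_norml; lra.
  by rewrite ler_norml => /andP[].
have dens1 : mean (fun x => \prod_i (1 + t * phi i x)) = 1.
  under eq_mean do rewrite dens.
  rewrite mean_sum (bigD1 set0)//= big1 => [|I I0]; last by rewrite meanZ mean_prod_phi// mulr0.
  rewrite (@eq_mean _ _ _ (fun=> 1)) ?mean_cst ?addr0// => x.
  by rewrite cards0 expr0 big_set0 mulr1.
suff <- : mean (fun x => S x * \prod_i (1 + t * phi i x)) =
    t * A + t ^+ 2 * \sum_(I : {set 'I_m} | #|I| == 2%N) c I.
  have dens_cst (a : R) : mean (fun x => a * \prod_i (1 + t * phi i x)) = a.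
    by rewrite meanZ dens1 mulr1.
  rewrite -{1}(dens_cst (- L)) -(dens_cst M); apply/andP; split; apply: le_mean => x.
    by rewrite ler_wpM2r//; case/andP: (SML x).
  by rewrite ler_wpM2r//; case/andP: (SML x).
rewrite (@eq_mean _ _ _ (fun x => \sum_(I : {set 'I_m})
    t ^+ #|I| * (S x * \prod_(j in I) phi j x))); last first.
  by move=> x; rewrite dens mulr_sumr; apply: eq_bigr => I _; rewrite mulrCA.
rewrite mean_sum.
under eq_bigr do rewrite meanZ -/(c _).
(* Sort the subsets by size: pairs give the t^2 term, larger sets vanish by locality, the empty set
   vanishes because X has mean 0, and singletons give [A]. *)
rewrite (bigID (fun I : {set 'I_m} => #|I| == 2%N))/= addrC; congr (_ + _); last first.
  by rewrite mulr_sumr; apply: eq_bigr => I /eqP->.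
rewrite (bigID (fun I : {set 'I_m} => #|I| == 1%N))/= [X in _ + X]big1 ?addr0; last first.
  move=> I /andP[I2 I1]; have [I3|] := ltnP 2 #|I|; first by rewrite /c mean_X_prod_phi// mulr0.
  rewrite leq_eqVlt (negbTE I2)/= ltnS leq_eqVlt (negbTE I1)/= ltnS leqn0 cards_eq0 => /eqP->.
  rewrite /c (@eq_mean _ _ _ S) ?S0 ?mulr0// => x.
  by rewrite big_set0 mulr1.
rewrite (eq_bigl (fun I : {set 'I_m} => #|I| == 1%N)) => [|I]; last first.
  by rewrite andb_idl// => /eqP->.
rewrite /A mulr_sumr.
rewrite big_cards1; apply: eq_bigr => i _; rewrite cards1 expr1; congr (_ * _).
by apply: eq_mean => x; rewrite big_set1.
Qed.
End Riesz.

(** * Khinchine's inequality in L1 *)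

Section Khinchine.
Variables (R : realType) (T : finType) (m : nat).
Variables (v : 'I_m -> T -> T) (x : 'I_m -> T -> R).
Hypothesis v_inj : forall k, injective (v k).
Hypothesis x_odd : forall k w, x k (v k w) = - x k w.
Hypothesis x_inv : forall k l w, k != l -> x l (v k w) = x l w.

Lemma sum_inv (g : R -> R) k ks w : k \notin ks ->
  \sum_(l <- ks) g (x l (v k w)) = \sum_(l <- ks) g (x l w).
Proof.
move=> kks; rewrite big_seq [RHS]big_seq; apply: eq_bigr => l lks.
by rewrite x_inv//; apply: contraNneq kks => ->.
Qed.

(** Cross terms are odd under one flip. The weight [W] makes room for negative powers of the square
    function, which every flip preserves. *)
Lemma mean_sqr_sum (W : T -> R) (ks : seq 'I_m) : uniq ks ->
  (forall k w, k \in ks -> W (v k w) = W w) ->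
  mean (fun w => W w * (\sum_(k <- ks) x k w) ^+ 2) =
  mean (fun w => W w * \sum_(k <- ks) x k w ^+ 2).
Proof.
elim: ks W => [|k ks IH] W /=.
  by move=> _ _; apply: eq_mean => w; rewrite !big_nil expr0n.
move=> /andP[kks uks] hW.
have -> : mean (fun w => W w * (\sum_(l <- k :: ks) x l w) ^+ 2) =
  mean (fun w => W w * x k w ^+ 2) + mean (fun w => W w * (\sum_(l <- ks) x l w) ^+ 2)
  + mean (fun w => 2 * W w * x k w * \sum_(l <- ks) x l w).
  by rewrite -!meanD; apply: eq_mean => w; rewrite big_cons; ring.
rewrite [X in _ + X](mean_odd (@v_inj k)); last first.
  move=> w /=; have /= -> := @sum_inv id k ks w kks; rewrite x_odd hW ?mem_head//; ring.
rewrite addr0 IH//; last by move=> l w lks; rewrite hW// in_cons lks orbT.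
by rewrite -meanD; apply: eq_mean => w; rewrite big_cons mulrDr.
Qed.

(** Odd powers of [x k] cancel. By [mean_sqr_sum] with weight W x_k^2, the mixed term with
    coefficient 6 becomes three times the mixed term, with coefficient 2, of the square on the
    right. *)
Lemma mean_expr4_sum (W : T -> R) (ks : seq 'I_m) : uniq ks -> (forall w, 0 <= W w) ->
  (forall k w, k \in ks -> W (v k w) = W w) ->
  mean (fun w => W w * (\sum_(k <- ks) x k w) ^+ 4) <=
  3 * mean (fun w => W w * (\sum_(k <- ks) x k w ^+ 2) ^+ 2).
Proof.
move=> + W0; elim: ks => [|k ks IH] /=.
  by move=> _ _; rewrite -meanZ; apply: le_mean => w; rewrite !big_nil !expr0n !mulr0.
move=> /andP[kks uks] hW.
have hW' l w : l \in ks -> W (v l w) = W w by move=> lks; rewrite hW// in_cons lks orbT.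
have -> : mean (fun w => W w * (\sum_(l <- k :: ks) x l w) ^+ 4) =
  mean (fun w => W w * x k w ^+ 4) + mean (fun w => W w * (\sum_(l <- ks) x l w) ^+ 4)
  + 6 * mean (fun w => (W w * x k w ^+ 2) * (\sum_(l <- ks) x l w) ^+ 2)
  + mean (fun w => 4 * W w * x k w * (x k w ^+ 2 * \sum_(l <- ks) x l w + (\sum_(l <- ks) x l w) ^+ 3)).
  by rewrite -meanZ -!meanD; apply: eq_mean => w; rewrite big_cons; ring.
rewrite [X in _ + X](mean_odd (@v_inj k)); last first.
  move=> w /=; have /= -> := @sum_inv id k ks w kks; rewrite x_odd hW ?mem_head//; ring.
rewrite addr0 mean_sqr_sum//; last first.
  move=> l w lks; rewrite hW'// x_inv//; by apply: contraNneq kks => <-.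
have -> : mean (fun w => W w * (\sum_(l <- k :: ks) x l w ^+ 2) ^+ 2) =
  mean (fun w => W w * x k w ^+ 4) + mean (fun w => W w * (\sum_(l <- ks) x l w ^+ 2) ^+ 2)
  + 2 * mean (fun w => (W w * x k w ^+ 2) * (\sum_(l <- ks) x l w ^+ 2)).
  by rewrite -meanZ -!meanD; apply: eq_mean => w; rewrite big_cons; ring.
have := IH uks hW'.
have : 0 <= mean (fun w => W w * x k w ^+ 4).
  by apply: mean_ge0 => w; rewrite mulr_ge0// exprn_even_ge0.
lra.
Qed.

(** Let s be the root of the sum of squares and z the sum. Cauchy-Schwarz bounds the left side by
    sqrt m times the mean of s. Then average |z| >= z^2/s - z^4/(6 s^3): the second moment gives s,
    and the fourth takes away at most s/2. *)
Lemma khinchine_l1 :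
  \sum_k mean (fun w => `|x k w|) <=
  2 * Num.sqrt m%:R * mean (fun w => `|\sum_k x k w|).
Proof.
pose q w := \sum_k x k w ^+ 2.
have q0 w : 0 <= q w by apply: sumr_ge0 => k _; rewrite sqr_ge0.
pose s w := Num.sqrt (q w).
have s0 w : 0 <= s w by rewrite sqrtr_ge0.
have s2 w : s w ^+ 2 = q w by rewrite sqr_sqrtr.
have q_inv k w : q (v k w) = q w.
  apply: eq_bigr => l _; have [->|kl] := eqVneq k l; first by rewrite x_odd sqrrN.
  by rewrite x_inv.
have s_inv k w : s (v k w) = s w by rewrite /s q_inv.
have sum_le w : \sum_k `|x k w| <= Num.sqrt m%:R * s w.
  have /orP[/eqP sw0|sw0] : (s w == 0) || (0 < s w) by rewrite -le0r.
    have qw0 : q w = 0 by rewrite -s2 sw0 expr0n.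
    rewrite sw0 mulr0 big1// => k _; apply/eqP; rewrite normr_eq0 -sqrf_eq0; apply/eqP.
    by apply: psumr_eq0P qw0 k isT => l _; rewrite sqr_ge0.
  have m0 : (0 < m)%N.
    rewrite lt0n; apply: contraTneq sw0 => m0; rewrite /s /q big1 ?sqrtr0 ?ltxx// => k.
    by have := ltn_ord k; rewrite [X in (_ < X)%N]m0.
  have rm0 : 0 < Num.sqrt m%:R :> R by rewrite sqrtr_gt0 ltr0n.
  set r := Num.sqrt _ in rm0 *.
  have r2 : r ^+ 2 = m%:R by rewrite sqr_sqrtr.
  (* Cauchy-Schwarz term by term: |x| <= (x^2 a + 1/a)/2 with a = [r / s w]. *)
  have : \sum_k `|x k w| <= \sum_k (x k w ^+ 2 * (r / s w) + s w / r) / 2.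
    apply: ler_sum => k _.
    rewrite -[x k w ^+ 2]real_normK ?num_real//; set y := `|_|.
    have : 0 <= (y * (r / s w) - 1) ^+ 2 * (s w / r).
      by rewrite mulr_ge0 ?sqr_ge0// divr_ge0// ltW.
    have -> : (y * (r / s w) - 1) ^+ 2 * (s w / r) = y ^+ 2 * (r / s w) + s w / r - 2 * y.
      by field; rewrite !gt_eqF.
    lra.
  move/le_trans; apply; rewrite -mulr_suml big_split/= -mulr_suml -/(q w) -s2 sumr_const card_ord.
  rewrite -[X in _ + X]mulr_natr -r2 -subr_ge0.
  suff -> : r * s w - (s w ^+ 2 * (r / s w) + s w / r * r ^+ 2) / 2 = 0 by [].
  by field; rewrite !gt_eqF.
have main : mean s <= 2 * mean (fun w => `|\sum_k x k w|).
  have -> : mean s = 2 * (mean (fun w => (s w)^-1 * \sum_(k <- index_enum 'I_m) x k w ^+ 2)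
     - 6^-1 * (3 * mean (fun w => ((s w) ^+ 3)^-1 * (\sum_(k <- index_enum 'I_m) x k w ^+ 2) ^+ 2))).
    rewrite -!meanZ -meanB -meanZ; apply: eq_mean => w.
    rewrite -/(q w) -s2; have [->|sw] := eqVneq (s w) 0; first by rewrite !expr0n/= ?invr0; ring.
    by field.
  have W0 w : 0 <= (s w ^+ 3)^-1 by rewrite invr_ge0 exprn_ge0.
  have Winv (k : 'I_m) w : k \in index_enum 'I_m -> (s (v k w) ^+ 3)^-1 = (s w ^+ 3)^-1.
    by rewrite s_inv.
  rewrite ler_wpM2l// -mean_sqr_sum ?index_enum_uniq//; last by move=> k w _; rewrite s_inv.
  have := mean_expr4_sum (index_enum_uniq _) W0 Winv.
  have i6 : 0 <= 6^-1 :> R by rewrite invr_ge0.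
  move=> /(ler_wpM2l i6) H; apply: (le_trans (lerB (lexx _) H)).
  rewrite -meanZ -meanB; apply: le_mean => w; set z := \sum_(k <- _) _.
  have [->|sw] := eqVneq (s w) 0; first by rewrite !expr0n/= ?invr0 !mul0r mulr0 subr0.
  have sp : 0 < s w by rewrite lt_neqAle eq_sym sw s0.
  rewrite -[z ^+ 2]real_normK ?num_real// (_ : z ^+ 4 = `|z| ^+ 4); last first.
    by rewrite -[4%N]/(2 * 2)%N !exprM real_normK ?num_real.
  move: `|z| (normr_ge0 z) => y y0; rewrite -subr_ge0.
  have -> : y - ((s w)^-1 * y ^+ 2 - 6^-1 * ((s w ^+ 3)^-1 * y ^+ 4)) =
    y * (1 - y / s w + (y / s w) ^+ 3 / 6) by field.
  rewrite mulr_ge0//; have : 0 <= y / s w by rewrite divr_ge0.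
  (* For t >= 0 the cubic 1 - t + t^3/6 is least at sqrt 2, for which 10/7 stands in; the factor 7t
     + 20 removes the quadratic term. *)
  move: (y / s w) => t t0; have : 0 <= (7 * t - 10) ^+ 2 * (7 * t + 20).
    by rewrite mulr_ge0 ?sqr_ge0//; lra.
  rewrite (_ : _ * _ = 343 * t ^+ 3 - 2100 * t + 2000); first lra.
  by ring.
rewrite (le_trans (y := Num.sqrt m%:R * mean s))//.
  by rewrite -meanZ -mean_sum; apply: le_mean.
by rewrite [2 * _]mulrC -mulrA ler_wpM2l ?sqrtr_ge0.
Qed.
End Khinchine.

(** * The effect of swapping two positions *)

Section Matrices.
Variables (R : realType) (n : nat).
Implicit Types (W U : wdigraph R n) (p q r : 'I_n) (s t : 'S_n).

(** This is [wd_relabel W s^-1]. Products of permutations act from left to right, so a left factor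
    permutes positions rather than labels. *)
Definition pull W s : wdigraph R n := fun x y => W (s x) (s y).

Definition wsum W U : R := \sum_x \sum_y W x y * U x y.

Definition outdeg W x : R := \sum_y W x y.
Definition indeg W x : R := \sum_y W y x.

Definition degP W p q : R := outdeg W p + indeg W p - (outdeg W q + indeg W q).
Definition degM W p q : R := outdeg W p - indeg W p - (outdeg W q - indeg W q).
Definition skewpart W p q : R := W p q - W q p.
Definition skewr W p q : R := skewpart W p q - degM W p q / n%:R.

Definition out4 W p q r r' : R := W p r - W q r - W p r' + W q r'.
Definition in4 W p q r r' : R := W r p - W r q - W r' p + W r' q.

(** The amount by which exchanging r and r' in [W], both outside p and q, lowers
    [swapgain W U p q]. *)
Definition corr4 W U p q r r' : R :=
  out4 W p q r r' * out4 U p q r r' + in4 W p q r r' * in4 U p q r r'.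

Definition swapgain W U p q : R :=
  \sum_(z | (z != p) && (z != q))
    ((W p z - W q z) * (U p z - U q z) + (W z p - W z q) * (U z p - U z q))
  + skewpart W p q * skewpart U p q.

(* The mean of [swapgain] over all relabellings fixing p and q, diagonalized: [skewr] vanishes
   on the graphs [f x + g y], and the three summands do not interact. *)
Definition stdgain W U p q : R :=
  (degP W p q * degP U p q + (n%:R - 2) / n%:R * (degM W p q * degM U p q)
   + 2 * n%:R * (skewr W p q * skewr U p q)) / (2 * (n%:R - 2)).

Lemma pullM W s t : pull W (t * s)%g = pull (pull W s) t.
Proof. by rewrite /pull; do 2![apply: boolp.funext => ?]; rewrite !permM. Qed.

Lemma outdeg_pull W s x : outdeg (pull W s) x = outdeg W (s x).
Proof. by rewrite /outdeg [RHS](reindex_inj (@perm_inj _ s)). Qed.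

Lemma indeg_pull W s x : indeg (pull W s) x = indeg W (s x).
Proof. by rewrite /indeg [RHS](reindex_inj (@perm_inj _ s)). Qed.

Lemma degP_pull W s p q : degP (pull W s) p q = degP W (s p) (s q).
Proof. by rewrite /degP !outdeg_pull !indeg_pull. Qed.

Lemma degM_pull W s p q : degM (pull W s) p q = degM W (s p) (s q).
Proof. by rewrite /degM !outdeg_pull !indeg_pull. Qed.

Lemma skewr_pull W s p q : skewr (pull W s) p q = skewr W (s p) (s q).
Proof. by rewrite /skewr degM_pull. Qed.

Lemma sum_split2 (F : 'I_n -> R) p q : p != q ->
  \sum_x F x = F p + F q + \sum_(z | (z != p) && (z != q)) F z.
Proof.
move=> pq; rewrite (bigD1 p)//= (bigD1 q) ?[q == p]eq_sym//= addrA; congr (_ + _).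
Qed.

Lemma sum2_split2 (F : 'I_n -> 'I_n -> R) p q : p != q ->
  \sum_x \sum_y F x y = F p p + F p q + F q p + F q q
  + \sum_(z | (z != p) && (z != q)) (F p z + F q z + F z p + F z q)
  + \sum_(x | (x != p) && (x != q)) \sum_(y | (y != p) && (y != q)) F x y.
Proof.
move=> pq; rewrite (sum_split2 _ pq) !(sum_split2 (F _) pq).
under [\sum_(_ | _) \sum__ _]eq_bigr do rewrite (sum_split2 _ pq).
rewrite !big_split/=; ring.
Qed.

Lemma wsum_swap W U p q : p != q -> (forall x, W x x = 0) ->
  wsum W U - wsum (pull W (tperm p q)) U = swapgain W U p q.
Proof.
move=> pq W0; rewrite /wsum -sumrB.
under eq_bigr do rewrite -sumrB.
rewrite (sum2_split2 _ pq) [X in _ + X]big1 => [|x /andP[xp xq]]; last first.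
  apply: big1 => y /andP[yp yq].
  by rewrite /pull !tpermD 1?eq_sym// subrr.
rewrite addr0 addrC /swapgain; congr (_ + _).
  apply: eq_bigr => z /andP[zp zq].
  by rewrite /pull tpermL tpermR tpermD 1?eq_sym//; ring.
by rewrite /pull /skewpart tpermL tpermR !W0; ring.
Qed.

Lemma sum_out_diff W p q : p != q -> (forall x, W x x = 0) ->
  \sum_(z | (z != p) && (z != q)) (W p z - W q z) =
  (degP W p q + degM W p q) / 2 - skewpart W p q.
Proof.
move=> pq W0; rewrite sumrB /degP /degM /outdeg.
by rewrite !(sum_split2 (W _) pq) !W0 /skewpart; field.
Qed.

Lemma sum_in_diff W p q : p != q -> (forall x, W x x = 0) ->
  \sum_(z | (z != p) && (z != q)) (W z p - W z q) =
  (degP W p q - degM W p q) / 2 + skewpart W p q.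
Proof.
move=> pq W0; rewrite sumrB /degP /degM /indeg.
by rewrite !(sum_split2 (fun x => W x _) pq) !W0 /skewpart; field.
Qed.

Definition gain (w u : wdigraph R n) (x : 'S_n * 'S_n) : R :=
  wsum (pull w x.1) (pull u x.2).

Definition lmul1 t (x : 'S_n * 'S_n) : 'S_n * 'S_n := ((t * x.1)%g, x.2).
Definition lmul2 t (x : 'S_n * 'S_n) : 'S_n * 'S_n := (x.1, (t * x.2)%g).

Lemma lmul1_inj t : injective (lmul1 t).
Proof. by move=> [a b] [c d] [/mulgI-> ->]. Qed.

Lemma lmul2_inj t : injective (lmul2 t).
Proof. by move=> [a b] [c d] [-> /mulgI->]. Qed.

Section Means.
Variables (w u : wdigraph R n).
Hypothesis w0 : forall x, w x x = 0.
Hypothesis u0 : forall x, u x x = 0.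
Variables (p q : 'I_n) (phi : 'S_n * 'S_n -> R).
Hypothesis pq : p != q.
Hypothesis phi_odd : forall x, phi (lmul1 (tperm p q) x) = - phi x.

(** Against an odd [phi], only the part of the gain that is odd under the swap counts, and that is
    half of its change. *)
Lemma mean_gain :
  mean (fun x => gain w u x * phi x) =
  mean (fun x => swapgain (pull w x.1) (pull u x.2) p q * phi x) / 2.
Proof.
have e : mean (fun x => wsum (pull (pull w x.1) (tperm p q)) (pull u x.2) * phi x)
   = - mean (fun x => gain w u x * phi x).
  rewrite -[in RHS](mean_inj _ (@lmul1_inj (tperm p q))) -meanN.
  by apply: eq_mean => x; rewrite phi_odd /gain /= pullM mulrN opprK.
have -> : mean (fun x => swapgain (pull w x.1) (pull u x.2) p q * phi x) =
   mean (fun x => gain w u x * phi x) - - mean (fun x => gain w u x * phi x).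
  rewrite -e -meanB; apply: eq_mean => x.
  by rewrite -wsum_swap// ?mulrBl// => y; rewrite /pull w0.
by rewrite opprK; field.
Qed.

(** Since [phi] does not notice an exchange of two positions of u outside p and q, the position read
    in u can be averaged independently of the one read in w. *)
Lemma mean_decouple (F G : wdigraph R n -> 'I_n -> R) :
  (2 < n)%N ->
  (forall x z z', z != p -> z != q -> z' != p -> z' != q -> 
     phi (lmul2 (tperm z z') x) = phi x) ->
  (forall W z z', z != p -> z != q -> z' != p -> z' != q -> 
     G (pull W (tperm z z')) z = G W z') ->
  mean (fun x => \sum_(z | (z != p) && (z != q)) F (pull w x.1) z * G (pull u x.2) z * phi x) =
  mean (fun x => (\sum_(z | (z != p) && (z != q)) F (pull w x.1) z)
       * (\sum_(z | (z != p) && (z != q)) G (pull u x.2) z) * phi x) / (n%:R - 2).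
Proof.
move=> n2 phi_inv G_eq.
have n20 : n%:R - 2 != 0 :> R by rewrite subr_eq0 eqr_nat gtn_eqF.
apply: (mulIf n20); rewrite divfK//.
have card2 : (n%:R - 2 : R) = \sum_(z : 'I_n | (z != p) && (z != q)) 1.
  have : \sum_(z : 'I_n) 1 = n%:R :> R by rewrite sumr_const card_ord.
  by rewrite (sum_split2 _ pq) => <-; ring.
rewrite mean_sum mulr_suml.
transitivity (\sum_(z | (z != p) && (z != q)) \sum_(z' | (z' != p) && (z' != q))
   mean (fun x => F (pull w x.1) z * G (pull u x.2) z' * phi x)).
  apply: eq_bigr => z /andP[zp zq]; rewrite card2 mulr_sumr; apply: eq_bigr => z' /andP[zp' zq'].
  rewrite mulr1 -[RHS](mean_inj _ (@lmul2_inj (tperm z z'))); apply: eq_mean => x.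
  rewrite /= phi_inv// pullM; congr (_ * _ * _); rewrite tpermC G_eq//.
rewrite -[RHS]/(mean _); under [RHS]eq_mean do rewrite -mulrA mulr_suml.
rewrite mean_sum; apply: eq_bigr => z _.
under [RHS]eq_mean do rewrite mulr_suml mulr_sumr.
by rewrite mean_sum; apply: eq_bigr => z' _; apply: eq_mean => x; rewrite mulrA.
Qed.

Lemma mean_gain_std : (2 < n)%N ->
  (forall x z z', z != p -> z != q -> z' != p -> z' != q -> 
     phi (lmul2 (tperm z z') x) = phi x) ->
  mean (fun x => gain w u x * phi x) =
  mean (fun x => stdgain (pull w x.1) (pull u x.2) p q * phi x) / 2.
Proof.
move=> n2 phi_inv; rewrite mean_gain; congr (_ / _).
have n20 : n%:R - 2 != 0 :> R by rewrite subr_eq0 eqr_nat gtn_eqF.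
have n0 : n%:R != 0 :> R by rewrite pnatr_eq0 -lt0n (ltn_trans _ n2).
have H1 := @mean_decouple (fun W z => W p z - W q z) (fun W z => W p z - W q z) n2 phi_inv.
have H2 := @mean_decouple (fun W z => W z p - W z q) (fun W z => W z p - W z q) n2 phi_inv.
transitivity (
  mean (fun x => \sum_(z | (z != p) && (z != q))
     (pull w x.1 p z - pull w x.1 q z) * (pull u x.2 p z - pull u x.2 q z) * phi x) +
  mean (fun x => \sum_(z | (z != p) && (z != q))
     (pull w x.1 z p - pull w x.1 z q) * (pull u x.2 z p - pull u x.2 z q) * phi x) +
  mean (fun x => skewpart (pull w x.1) p q * skewpart (pull u x.2) p q * phi x)).
  rewrite -!meanD; apply: eq_mean => x.
  by rewrite /swapgain mulrDl; congr (_ + _); rewrite -!mulr_suml -mulrDl -big_split.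
have tp z z' : z != p -> z != q -> z' != p -> z' != q ->
  (tperm z z' p = p) * (tperm z z' q = q).
  by move=> *; rewrite !tpermD.
rewrite H1 ?H2; last 2 first.
- by move=> W z z' zp zq zp' zq'; rewrite /pull !tp// tpermL.
- by move=> W z z' zp zq zp' zq'; rewrite /pull !tp// tpermL.
rewrite ![mean _ / _]mulrC -!meanZ -!meanD; apply: eq_mean => x.
have w0x y : pull w x.1 y y = 0 by rewrite /pull.
have u0x y : pull u x.2 y y = 0 by rewrite /pull.
(* The remaining cross terms pair [degM] with [skewpart]; the shift by [degM / n] in [skewr] cancels
   them. *)
rewrite (sum_out_diff pq w0x) (sum_out_diff pq u0x) (sum_in_diff pq w0x) (sum_in_diff pq u0x).
by rewrite /stdgain /skewr /skewpart; field; rewrite n0 n20.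
Qed.

End Means.

End Matrices.

(** * Alternating sums over 4-cycles *)

Lemma exists_flip (T K : finType) (f : K * bool -> T) : injective f ->
  exists nu : {perm T}, (forall k b, nu (f (k, b)) = f (k, ~~ b)) /\
    (forall z, z \notin f @: setT -> nu z = z).
Proof.
move=> f_inj.
pose g z := if [pick kb | f kb == z] is Some kb then f (kb.1, ~~ kb.2) else z.
have gf k b : g (f (k, b)) = f (k, ~~ b).
  rewrite /g; case: pickP => [kb /eqP/f_inj ->//|/(_ (k, b))].
  by rewrite eqxx.
have gz z : z \notin f @: setT -> g z = z.
  by rewrite /g; case: pickP => // kb /eqP <-; rewrite imset_f.
have gK : involutive g.
  move=> z; have [/imsetP[[k b] _ ->]|zf] := boolP (z \in f @: setT).
    by rewrite !gf negbK.
  by rewrite !gz.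
exists (perm (inv_inj gK)); split=> [k b|z zf]; first by rewrite permE gf.
by rewrite permE gz.
Qed.

Section Correlation.
Variables (R : realType) (n : nat).
Implicit Types (W U w u : wdigraph R n) (p q r : 'I_n).

Definition sym4 W p q r r' : R := out4 W p q r r' + in4 W p q r r'.
Definition asym4 W p q r r' : R := out4 W p q r r' - in4 W p q r r'.

Lemma corr4_swap1 W U p q r r' : r != p -> r != q -> r' != p -> r' != q ->
  corr4 (pull W (tperm p q)) U p q r r' = - corr4 W U p q r r'.
Proof.
move=> rp rq rp' rq'; rewrite /corr4 /out4 /in4 /pull tpermL tpermR.
by rewrite !(@tpermD _ p q r) 1?eq_sym// !(@tpermD _ p q r') 1?eq_sym//; ring.
Qed.

Lemma corr4_swap2 W U p q r r' : r != p -> r != q -> r' != p -> r' != q ->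
  corr4 (pull W (tperm r r')) U p q r r' = - corr4 W U p q r r'.
Proof.
move=> rp rq rp' rq'; rewrite /corr4 /out4 /in4 /pull tpermL tpermR.
by rewrite !(@tpermD _ r r' p)// !(@tpermD _ r r' q)//; ring.
Qed.

Lemma corr4_fix W U (t : 'S_n) p q r r' : t p = p -> t q = q -> t r = r -> t r' = r' ->
  corr4 (pull W t) U p q r r' = corr4 W U p q r r'.
Proof. by rewrite /corr4 /out4 /in4 /pull => -> -> -> ->. Qed.

Definition gain4 w u p q r r' (x : 'S_n * 'S_n) : R :=
  corr4 (pull w x.1) (pull u x.2) p q r r'.

(* Exchanging p with r and q with r' in w swaps [out4] and [in4] there, so that the two
   products of [corr4] cannot cancel on average. *)
Lemma mean_gain4 w u p q r r' : uniq [:: p; q; r; r'] ->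
  mean (fun s => `|sym4 (pull w s) p q r r'|) * mean (fun t => `|sym4 (pull u t) p q r r'|)
    <= 2 * mean (fun x => `|gain4 w u p q r r' x|) /\
  mean (fun s => `|asym4 (pull w s) p q r r'|) * mean (fun t => `|asym4 (pull u t) p q r r'|)
    <= 2 * mean (fun x => `|gain4 w u p q r r' x|).
Proof.
rewrite /= !inE !negb_or -!andbA => /and5P[pq pr pr' qr /andP[qr' /andP[rr' _]]].
pose k : 'S_n := (tperm p r * tperm q r')%g.
have kE : (k p = r) * (k r = p) * (k q = r') * (k r' = q).
  by rewrite /k !permM tpermL tpermR !(@tpermD _ p r q) ?(@tpermD _ p r r')//
    ?tpermL ?tpermR ?tpermD// 1?eq_sym.
have outk W : out4 (pull W k) p q r r' = in4 W p q r r'.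
  by rewrite /out4 /in4 /pull !kE; ring.
have ink W : in4 (pull W k) p q r r' = out4 W p q r r'.
  by rewrite /out4 /in4 /pull !kE; ring.
rewrite -!mean_prod; set g := gain4 w u p q r r'.
have -> : 2 * mean (fun x => `|g x|) = mean (fun x => `|g x| + `|g (lmul1 k x)|).
  by rewrite meanD (mean_inj (fun x => `|g x|) (@lmul1_inj _ k)); ring.
split; apply: le_mean => x; rewrite -normrM.
  apply: le_trans (ler_normD _ _); rewrite /g /gain4 /corr4 /= pullM outk ink /sym4.
  by rewrite le_eqVlt; apply/orP; left; apply/eqP; congr `|_|; ring.
apply: le_trans (ler_normB _ _); rewrite /g /gain4 /corr4 /= pullM outk ink /asym4.
by rewrite le_eqVlt; apply/orP; left; apply/eqP; congr `|_|; ring.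
Qed.

Section Gain.
Variables (w u : wdigraph R n) (p q : 'I_n) (m : nat) (f : 'I_m * bool -> 'I_n).
Hypothesis w0 : forall x, w x x = 0.
Hypothesis pq : p != q.
Hypothesis f_inj : injective f.
Hypothesis fp : forall kb, f kb != p.
Hypothesis fq : forall kb, f kb != q.

Definition corrsum (x : 'S_n * 'S_n) : R :=
  \sum_k gain4 w u p q (f (k, false)) (f (k, true)) x.

Lemma corrsum_swap x : corrsum (lmul1 (tperm p q) x) = - corrsum x.
Proof.
by rewrite /corrsum -sumrN; apply: eq_bigr => k _; rewrite /gain4/= pullM corr4_swap1.
Qed.

(** Positions outside the pairs contribute nothing, and the two positions of a pair together
    contribute its [gain4]. *)
Lemma swapgain_flip (nu : 'S_n) x :
  (forall k b, nu (f (k, b)) = f (k, ~~ b)) ->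
  (forall z, z \notin f @: setT -> nu z = z) ->
  swapgain (pull w x.1) (pull u x.2) p q
    - swapgain (pull w (lmul1 nu x).1) (pull u x.2) p q = corrsum x.
Proof.
move=> nuf nuz; rewrite /= pullM; set W := pull w _; set U := pull u _.
have nup : nu p = p by rewrite nuz//; apply/imsetP => -[kb _ e]; move: (fp kb); rewrite e eqxx.
have nuq : nu q = q by rewrite nuz//; apply/imsetP => -[kb _ e]; move: (fq kb); rewrite e eqxx.
pose G z := (W p z - W q z - (W p (nu z) - W q (nu z))) * (U p z - U q z) +
  (W z p - W z q - (W (nu z) p - W (nu z) q)) * (U z p - U z q).
have -> : swapgain W U p q - swapgain (pull W nu) U p q = \sum_(z | (z != p) && (z != q)) G z.
  rewrite /swapgain /skewpart /pull nup nuq opprD addrACA subrr addr0 -sumrB.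
  by apply: eq_bigr => z _; rewrite /G; ring.
transitivity (\sum_(z in f @: setT) G z).
  rewrite (bigID (fun z => z \in f @: setT))/= [X in _ + X]big1 ?addr0 => [|z /andP[_ zf]]; last first.
    by rewrite /G nuz// !subrr; ring.
  apply: eq_bigl => z; rewrite andb_idl// => /imsetP[kb _ ->].
  by rewrite fp fq.
rewrite big_imset/=; last by move=> ? ? _ _; apply: f_inj.
rewrite (eq_bigl predT) => [|kb]; last by rewrite inE.
transitivity (\sum_k \sum_b G (f (k, b))).
  by rewrite pair_bigA/=; apply: eq_bigr => -[].
apply: eq_bigr => k _.
by rewrite big_bool /G !nuf/= /gain4 /corr4 /out4 /in4 -/W -/U; ring.
Qed.

(** The sign of [corrsum] is odd both under the swap of p and q and under the flip of all pairs in
    w. Antisymmetrising under each costs a factor 2 and leaves [corrsum] times its sign. *)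
Lemma mean_gain_corr :
  mean (fun x => gain w u x * Num.sg (corrsum x)) = mean (fun x => `|corrsum x|) / 4.
Proof.
rewrite (mean_gain u w0 pq); last by move=> x; rewrite corrsum_swap sgrN.
have [nu [nuf nuz]] := exists_flip f_inj.
have corr_nu x : corrsum (lmul1 nu x) = - corrsum x.
  rewrite /corrsum -sumrN; apply: eq_bigr => k _; rewrite /gain4/= pullM.
  have nup : nu p = p by rewrite nuz//; apply/imsetP => -[kb _ e]; move: (fp kb); rewrite e eqxx.
  have nuq : nu q = q by rewrite nuz//; apply/imsetP => -[kb _ e]; move: (fq kb); rewrite e eqxx.
  by rewrite /corr4 /out4 /in4 /pull nup nuq !nuf/=; ring.
set Y := mean _.
have e : mean (fun x => swapgain (pull w (lmul1 nu x).1) (pull u x.2) p q * Num.sg (corrsum x)) = - Y.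
  rewrite /Y -[in RHS](mean_inj _ (@lmul1_inj _ nu)) -meanN.
  by apply: eq_mean => x; rewrite corr_nu sgrN mulrN opprK.
have : mean (fun x => `|corrsum x|) = Y - - Y.
  rewrite -e -meanB; apply: eq_mean => x.
  by rewrite -mulrBl swapgain_flip// mulrC -normrEsg.
by move=> ->; field.
Qed.

(** Khinchine applies because exchanging the two positions of one pair in w reverses the sign of
    that summand and fixes the others. *)
Lemma mean_corrsum :
  \sum_k mean (fun x => `|gain4 w u p q (f (k, false)) (f (k, true)) x|) <=
  2 * Num.sqrt m%:R * mean (fun x => `|corrsum x|).
Proof.
have fneq (k l : 'I_m) b c : k != l -> f (k, b) != f (l, c).
  by apply: contraNneq => /f_inj[->].
apply: (@khinchine_l1 _ _ _ (fun k => lmul1 (tperm (f (k, false)) (f (k, true))))).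
- by move=> k; apply: lmul1_inj.
- by move=> k x; rewrite /gain4/= pullM corr4_swap2.
- move=> k l x kl; rewrite /gain4/= pullM corr4_fix//; apply: tpermD; by rewrite ?fneq// eq_sym.
Qed.

End Gain.
End Correlation.

(** * Averaging over positions *)

Lemma exists_perm_seq (T : finType) (l l' : seq T) : uniq l -> uniq l' -> size l = size l' ->
  exists s : {perm T}, map s l = l'.
Proof.
elim: l l' => [|a l IH] [|a' l']//=; first by exists 1%g.
move=> /andP[al ul] /andP[al' ul'] [sz]; have [s sl] := IH _ ul ul' sz.
exists (s * tperm (s a) a')%g; rewrite permM tpermL; congr (_ :: _); rewrite -[RHS]sl.
apply/eq_in_map => x xl; rewrite permM tpermD//.
  by apply: contraNneq al => /perm_inj ->.
by apply: contraNneq al' => ->; rewrite -sl map_f.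
Qed.

Section Positions.
Variables (R : realType) (n : nat).
Implicit Types (w W : wdigraph R n) (p q r : 'I_n).

(** The images of distinct positions under a uniform permutation have a law depending only on their
    number. Sequences serve all arities at once; uses read them through [nth]. *)
Lemma mean_pos (G : seq 'I_n -> R) (l l' : seq 'I_n) : uniq l -> uniq l' -> size l = size l' ->
  mean (fun s : 'S_n => G (map s l)) = mean (fun s : 'S_n => G (map s l')).
Proof.
move=> ul ul' sz; have [t <-] := exists_perm_seq ul ul' sz.
rewrite -(mean_inj (fun s : 'S_n => G (map s l)) (mulgI t)); apply: eq_mean => s.
by rewrite -map_comp; congr G; apply: eq_map => x; rewrite /= permM.
Qed.

Lemma card_perm_gt0 : (0 < #|{: 'S_n}|)%N.
Proof. by apply/card_gt0P; exists 1%g. Qed.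

Lemma sum_cst (I : finType) (P : pred I) (c : R) : \sum_(i | P i) c = (\sum_(i | P i) 1) * c.
Proof. by rewrite mulr_suml; under [RHS]eq_bigr do rewrite mul1r. Qed.

Lemma sum1_ord : \sum_(i < n) 1 = n%:R :> R.
Proof. by rewrite sumr_const card_ord. Qed.

Lemma sum1_neq p : \sum_(q | q != p) 1 = n%:R - 1 :> R.
Proof. by rewrite -sum1_ord [in RHS](bigD1 p)//=; ring. Qed.

Lemma sum1_neq2 p q : p != q -> \sum_(z | (z != p) && (z != q)) 1 = n%:R - 2 :> R.
Proof. by move=> pq; rewrite -sum1_ord [in RHS](sum_split2 _ pq); ring. Qed.

Lemma sum_cst_neq2 p q (c : R) : p != q ->
  \sum_(z | (z != p) && (z != q)) c = (n%:R - 2) * c.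
Proof. by move=> pq; rewrite sum_cst sum1_neq2. Qed.

Lemma mean_off w p q : p != q ->
  n%:R * (n%:R - 1) * mean (fun s : 'S_n => w (s p) (s q)) = wd_total w.
Proof.
move=> pq.
have -> : n%:R * (n%:R - 1) * mean (fun s : 'S_n => w (s p) (s q)) =
   \sum_x \sum_(y | x != y) mean (fun s : 'S_n => w (s x) (s y)).
  rewrite -mulrA -{1}sum1_ord mulr_suml; apply: eq_bigr => x _.
  rewrite mul1r -(sum1_neq x) mulr_suml.
  rewrite (eq_bigl (fun y => x != y)) => [|y]; last by rewrite eq_sym.
  apply: eq_bigr => y xy; rewrite mul1r.
  apply: (@mean_pos (fun l => w (nth p l 0) (nth p l 1)) [:: p; q] [:: x; y]) => //=;
    by rewrite inE andbT.
under eq_bigr do rewrite -mean_sum.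
rewrite -mean_sum -[RHS](mean_cst _ card_perm_gt0); apply: eq_mean => s.
rewrite /wd_total [RHS](reindex_inj (@perm_inj _ s)); apply: eq_bigr => x _.
rewrite [RHS](reindex_inj (@perm_inj _ s)); apply: eq_bigl => y.
by rewrite (inj_eq (@perm_inj _ s)).
Qed.

Lemma mean_pos2 (G : seq 'I_n -> seq 'I_n -> R) (l l' : seq 'I_n) :
  uniq l -> uniq l' -> size l = size l' ->
  mean (fun x : 'S_n * 'S_n => G (map x.1 l) (map x.2 l)) =
  mean (fun x : 'S_n * 'S_n => G (map x.1 l') (map x.2 l')).
Proof.
move=> ul ul' sz; have [t <-] := exists_perm_seq ul ul' sz.
rewrite -(mean_inj (fun x : 'S_n * 'S_n => G (map x.1 l) (map x.2 l))
  (inj_comp (@lmul1_inj _ t) (@lmul2_inj _ t))).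
apply: eq_mean => x; rewrite -!map_comp; congr (G _ _);
  by apply: eq_map => y; rewrite /= permM.
Qed.

(** The differences h(s p) - h(s z), summed over z != p, give n h(s p); the triangle inequality then
    suffices. *)
Lemma mean_norm_centered (h : 'I_n -> R) p q : p != q -> \sum_x h x = 0 ->
  mean (fun s : 'S_n => `|h (s p)|) <= mean (fun s : 'S_n => `|h (s p) - h (s q)|).
Proof.
move=> pq h0.
have n1 : 0 < n%:R - 1 :> R.
  by rewrite -(sum1_neq p) (bigD1 q) 1?eq_sym//= ltr_pwDl// sumr_ge0.
rewrite -(ler_pM2l n1).
have -> : (n%:R - 1) * mean (fun s : 'S_n => `|h (s p) - h (s q)|) =
   \sum_(z | z != p) mean (fun s : 'S_n => `|h (s p) - h (s z)|).
  rewrite -(sum1_neq p) mulr_suml; apply: eq_bigr => z zp; rewrite mul1r.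
  apply: (@mean_pos (fun l => `|h (nth p l 0) - h (nth p l 1)|) [:: p; q] [:: p; z]) => //=;
    by rewrite inE andbT// eq_sym.
rewrite -mean_sum -meanZ; apply: le_mean => s.
apply: le_trans (ler_norm_sum _ _ _).
rewrite sumrB sum_cst sum1_neq.
have -> : \sum_(z | z != p) h (s z) = - h (s p).
  have : \sum_z h (s z) = 0 by rewrite -[RHS]h0 [RHS](reindex_inj (@perm_inj _ s)).
  by rewrite (bigD1 p)//=; lra.
rewrite (_ : (n%:R - 1) * h (s p) - - h (s p) = n%:R * h (s p)); last by ring.
by rewrite normrM ler_wpM2r// ger0_norm ?ler0n//; lra.
Qed.

(** Vanishing degrees let the alternating sums be inverted: summing over q and r' recovers W p r up
    to scale. The stray W r p comes from the excluded diagonal and coincidences. *)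
Lemma sum_out4 W p r : p != r -> (forall x, W x x = 0) ->
  (forall x, outdeg W x = 0) -> (forall x, indeg W x = 0) ->
  \sum_(q | (q != p) && (q != r)) \sum_(r' | (r' != p) && (r' != r) && (r' != q)) out4 W p q r r' =
  ((n%:R - 2) ^+ 2 + (n%:R - 2) - 1) * W p r + W r p.
Proof.
move=> pr W0 Wo Wi; set N := n%:R - 2.
have eD q : (q != p) && (q != r) ->
   \sum_(r' | (r' != p) && (r' != r) && (r' != q)) out4 W p q r r' =
   \sum_(r' | (r' != p) && (r' != r)) out4 W p q r r' - out4 W p q r q.
  by move=> hq; rewrite [in RHS](bigD1 q)//= addrAC subrr add0r.
rewrite (eq_bigr _ eD) sumrB.
have row a b : a != b -> \sum_(z | (z != a) && (z != b)) W a z = - W a b.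
  by move=> ab; have := Wo a; rewrite /outdeg (sum_split2 _ ab) W0; lra.
have row' a b : a != b -> \sum_(z | (z != a) && (z != b)) W b z = - W b a.
  by move=> ab; have := Wo b; rewrite /outdeg (sum_split2 _ ab) W0; lra.
have col a b : a != b -> \sum_(z | (z != a) && (z != b)) W z a = - W b a.
  by move=> ab; have := Wi a; rewrite /indeg (sum_split2 (fun z => W z a) ab) W0; lra.
have col' a b : a != b -> \sum_(z | (z != a) && (z != b)) W z b = - W a b.
  by move=> ab; have := Wi b; rewrite /indeg (sum_split2 (fun z => W z b) ab) W0; lra.
have tot : \sum_(q | (q != p) && (q != r)) \sum_(r' | (r' != p) && (r' != r)) W q r' = W p r + W r p.
  have : \sum_x \sum_y W x y = 0 by apply: big1 => x _; apply: Wo.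
  rewrite (sum2_split2 _ pr) !W0 !big_split/= row// row'// col// col'//; lra.
have -> : \sum_(q | (q != p) && (q != r)) \sum_(r' | (r' != p) && (r' != r)) out4 W p q r r' =
  N * N * W p r + N * W p r + N * W p r + (W p r + W r p).
  rewrite -tot /out4.
  under eq_bigr do rewrite big_split/= !sumrB/= !sum_cst_neq2// row//.
  rewrite big_split/= !sumrB/= !sum_cst_neq2// -mulr_sumr col'// -/N; ring.
have -> : \sum_(q | (q != p) && (q != r)) out4 W p q r q = N * W p r + W p r + W p r.
  rewrite /out4; under eq_bigr do rewrite W0 addr0.
  by rewrite !sumrB sum_cst_neq2// row// col'// -/N; ring.
ring.
Qed.

Lemma mean_out4 W p q r r' : (4 <= n)%N -> uniq [:: p; q; r; r'] -> (forall x, W x x = 0) ->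
  (forall x, outdeg W x = 0) -> (forall x, indeg W x = 0) ->
  mean (fun s : 'S_n => `|W (s p) (s r)|) <= mean (fun s : 'S_n => `|out4 (pull W s) p q r r'|).
Proof.
move=> n4 u4 W0 Wo Wi; set A := mean _; set B := mean _.
have pr : p != r by move: u4; rewrite /= !inE !negb_or -!andbA => /and5P[].
have n4R : 4 <= n%:R :> R by rewrite ler_nat.
set N : R := n%:R - 2; have N2 : 2 <= N by rewrite /N; lra.
have eB : \sum_(q | (q != p) && (q != r)) \sum_(r' | (r' != p) && (r' != r) && (r' != q))
   mean (fun s : 'S_n => `|out4 (pull W s) p q r r'|) = N * (N - 1) * B.
  have eD z : (z != p) && (z != r) ->
     \sum_(r' | (r' != p) && (r' != r) && (r' != z)) (1 : R) = N - 1.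
    by move=> hz; rewrite /N -(sum1_neq2 pr) [in RHS](bigD1 z)//= addrAC subrr add0r.
  rewrite -mulrA {1}/N -(sum1_neq2 pr) mulr_suml; apply: eq_bigr => z hz.
  rewrite -(eD _ hz) mul1r mulr_suml; apply: eq_bigr => z' /andP[/andP[z'p z'r] z'z].
  case/andP: hz => zp zr; rewrite mul1r.
  apply: (@mean_pos (fun l => `|W (nth p l 0) (nth p l 2) - W (nth p l 1) (nth p l 2)
     - W (nth p l 0) (nth p l 3) + W (nth p l 1) (nth p l 3)|)
     [:: p; z; r; z'] [:: p; q; r; r']) => //=.
  by rewrite !inE !negb_or pr zr ![p == _]eq_sym ![r == _]eq_sym [z == z']eq_sym zp z'p z'r z'z.
have H : mean (fun s : 'S_n => `|(N ^+ 2 + N - 1) * W (s p) (s r) + W (s r) (s p)|) <= N * (N - 1) * B.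
  rewrite -eB; under eq_bigr do rewrite -mean_sum.
  rewrite -mean_sum; apply: le_mean => s.
  have := @sum_out4 (pull W s) p r pr; rewrite -/N => <-.
  - by apply: le_trans (ler_norm_sum _ _ _) _; apply: ler_sum => z _; apply: ler_norm_sum.
  - by move=> x; apply: W0.
  - by move=> x; rewrite outdeg_pull.
  - by move=> x; rewrite indeg_pull.
have eA : mean (fun s : 'S_n => `|W (s r) (s p)|) = A.
  apply: (@mean_pos (fun l => `|W (nth p l 0) (nth p l 1)|) [:: r; p] [:: p; r]) => //=;
    by rewrite inE andbT// eq_sym.
(* The reversed entry has the same mean modulus [A]; what remains, N^2 + N - 2, is still at least
   N(N - 1). *)
have : (N ^+ 2 + N - 1) * A - A <= N * (N - 1) * B.
  apply: le_trans H; rewrite -{2}eA -meanZ -meanB; apply: le_mean => s.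
  rewrite -[X in X * _ - _]ger0_norm; last by nra.
  by rewrite -normrM -[X in _ - X]normrN; apply: le_trans (lerB_dist _ _) _; rewrite opprK.
have A0 : 0 <= A by apply: mean_ge0.
move=> H2; have : N * (N - 1) * A <= N * (N - 1) * B by nra.
by rewrite ler_pM2l//; nra.
Qed.

End Positions.

(** * Graphs determined by their degrees *)

Section Residual.
Variables (R : realType) (n : nat) (w : wdigraph R n).
Hypothesis n4 : (4 <= n)%N.
Hypothesis w0 : forall x, w x x = 0.
Hypothesis wtot : \sum_x outdeg w x = 0.

(* The function [x y => outpot x + inpot y] has the same out- and indegrees as w. *)
Definition outpot x : R := ((n%:R - 1) * outdeg w x + indeg w x) / (n%:R * (n%:R - 2)).
Definition inpot x : R := ((n%:R - 1) * indeg w x + outdeg w x) / (n%:R * (n%:R - 2)).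
Definition resid : wdigraph R n :=
  fun x y => if x == y then 0 else w x y - outpot x - inpot y.

Let n4R : 4 <= n%:R :> R. Proof. by rewrite ler_nat. Qed.
Let n_neq0 : n%:R != 0 :> R. Proof. rewrite gt_eqF//. move: n4R; lra. Qed.
Let n2_neq0 : n%:R - 2 != 0 :> R. Proof. by rewrite gt_eqF//; move: n4R; lra. Qed.

Lemma sum_indeg : \sum_x indeg w x = 0.
Proof. by rewrite /indeg exchange_big. Qed.

Lemma sum_outpot : \sum_x outpot x = 0.
Proof. by rewrite -mulr_suml big_split/= -mulr_sumr wtot sum_indeg mulr0 addr0 mul0r. Qed.

Lemma sum_inpot : \sum_x inpot x = 0.
Proof. by rewrite -mulr_suml big_split/= -mulr_sumr wtot sum_indeg mulr0 addr0 mul0r. Qed.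

Lemma resid_diag x : resid x x = 0. Proof. by rewrite /resid eqxx. Qed.

Lemma outdeg_resid x : outdeg resid x = 0.
Proof.
rewrite /outdeg (bigD1 x)//= resid_diag add0r.
rewrite (eq_bigr (fun y => w x y - outpot x - inpot y)) => [|y yx]; last first.
  by rewrite /resid eq_sym (negbTE yx).
rewrite !sumrB sum_cst sum1_neq.
have : outdeg w x = \sum_(y | y != x) w x y by rewrite /outdeg (bigD1 x)//= w0 add0r.
have : inpot x + \sum_(y | y != x) inpot y = 0 by rewrite -[RHS]sum_inpot [RHS](bigD1 x).
move=> /eqP; rewrite addrC addr_eq0 => /eqP -> <-; rewrite /outpot /inpot; field.
by rewrite n_neq0 n2_neq0.
Qed.

Lemma indeg_resid x : indeg resid x = 0.
Proof.
rewrite /indeg (bigD1 x)//= resid_diag add0r.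
rewrite (eq_bigr (fun y => w y x - outpot y - inpot x)) => [|y yx]; last first.
  by rewrite /resid (negbTE yx).
rewrite !sumrB sum_cst sum1_neq.
have : indeg w x = \sum_(y | y != x) w y x by rewrite /indeg (bigD1 x)//= w0 add0r.
have : outpot x + \sum_(y | y != x) outpot y = 0 by rewrite -[RHS]sum_outpot [RHS](bigD1 x).
move=> /eqP; rewrite addrC addr_eq0 => /eqP -> <-; rewrite /outpot /inpot; field.
by rewrite n_neq0 n2_neq0.
Qed.

Lemma skewr_resid p q : p != q -> skewr w p q = resid p q - resid q p.
Proof.
move=> pq; rewrite /resid [q == p]eq_sym (negbTE pq) /skewr /skewpart /degM /outpot /inpot.
by field; rewrite n_neq0 n2_neq0.
Qed.

(** Alternating sums annihilate f(x) + g(y), so w and its residual have the same ones, and the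
    residual has zero degrees. *)
Lemma mean_resid p q r r' : uniq [:: p; q; r; r'] ->
  mean (fun s : 'S_n => `|resid (s p) (s r)|) <=
  mean (fun s : 'S_n => `|out4 (pull w s) p q r r'|).
Proof.
move=> u4; apply: le_trans (mean_out4 n4 u4 resid_diag outdeg_resid indeg_resid) _.
apply: le_mean => s; rewrite le_eqVlt; apply/orP; left; apply/eqP; congr `|_|.
move: u4; rewrite /= !inE !negb_or -!andbA => /and5P[pq pr pr' qr /andP[qr' _]].
rewrite /out4 /pull /resid !(inj_eq (@perm_inj _ s)).
by rewrite (negbTE pr) (negbTE qr) (negbTE pr') (negbTE qr'); ring.
Qed.

Lemma mean_skewr p q r r' p' q' : uniq [:: p; q; r; r'] -> p' != q' ->
  mean (fun s : 'S_n => `|skewr w (s p') (s q')|) <=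
  2 * mean (fun s : 'S_n => `|out4 (pull w s) p q r r'|).
Proof.
move=> u4 pq'.
have pr : p != r by move: u4; rewrite /= !inE !negb_or -!andbA => /and5P[].
have e a b : a != b ->
    mean (fun s : 'S_n => `|resid (s a) (s b)|) = mean (fun s : 'S_n => `|resid (s p) (s r)|).
  move=> ab.
  apply: (@mean_pos _ _ (fun l => `|resid (nth p l 0) (nth p l 1)|) [:: a; b] [:: p; r]) => //=;
    by rewrite inE andbT.
have := mean_resid u4.
have : mean (fun s : 'S_n => `|skewr w (s p') (s q')|) <=
  mean (fun s : 'S_n => `|resid (s p') (s q')|) + mean (fun s : 'S_n => `|resid (s q') (s p')|).
  rewrite -meanD; apply: le_mean => s.
  by rewrite skewr_resid ?(inj_eq (@perm_inj _ s))//; apply: ler_normB.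
rewrite !e// 1?eq_sym//; lra.
Qed.

(** The mean of |w| is 1 and the residual accounts for at most the alternating sums, so the
    potentials, hence the degree differences, carry the rest. *)
Lemma mean_deg_ge p q r r' p' q' : uniq [:: p; q; r; r'] -> p' != q' ->
  wd_norm1 w = n%:R * (n%:R - 1) ->
  (1 - mean (fun s : 'S_n => `|out4 (pull w s) p q r r'|)) / 2 <=
  mean (fun s : 'S_n => `|degP w (s p') (s q') / n%:R| + `|degM w (s p') (s q') / n%:R|).
Proof.
move=> u4 pq' w1.
have pr : p != r by move: u4; rewrite /= !inE !negb_or -!andbA => /and5P[].
have H1 : mean (fun s : 'S_n => `|w (s p') (s q')|) = 1.
  have nn : n%:R * (n%:R - 1) != 0 :> R by rewrite mulf_neq0// gt_eqF//; move: n4R; lra.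
  by apply: (mulfI nn); rewrite mulr1 (mean_off (fun x y => `|w x y|)).
have H2 : mean (fun s : 'S_n => `|resid (s p') (s q')|) <=
    mean (fun s : 'S_n => `|out4 (pull w s) p q r r'|).
  apply: le_trans (mean_resid u4); rewrite le_eqVlt; apply/orP; left; apply/eqP.
  apply: (@mean_pos _ _ (fun l => `|resid (nth p l 0) (nth p l 1)|) [:: p'; q'] [:: p; r]) => //=;
    by rewrite inE andbT.
(* This is [outpot + inpot]; the difference [outpot - inpot] is (outdeg - indeg)/n and only enters
   through [degM]. *)
pose h x := (outdeg w x + indeg w x) / (n%:R - 2).
have h0 : \sum_x h x = 0 by rewrite -mulr_suml big_split/= wtot sum_indeg addr0 mul0r.
have H3 := mean_norm_centered pq' h0.
have H3' : mean (fun s : 'S_n => `|h (s q')|) = mean (fun s : 'S_n => `|h (s p')|).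
  exact: (@mean_pos _ _ (fun l => `|h (nth p l 0)|) [:: q'] [:: p']).
have H4 : mean (fun s : 'S_n => `|h (s p') - h (s q')|) <=
    2 * mean (fun s : 'S_n => `|degP w (s p') (s q') / n%:R|).
  rewrite -meanZ; apply: le_mean => s.
  have -> : h (s p') - h (s q') = (n%:R / (n%:R - 2)) * (degP w (s p') (s q') / n%:R).
    by rewrite /h /degP; field; rewrite n_neq0 n2_neq0.
  rewrite normrM ler_wpM2r// ger0_norm; last by rewrite divr_ge0//; move: n4R; lra.
  by rewrite ler_pdivrMr; move: n4R; lra.
have : mean (fun s : 'S_n => `|w (s p') (s q')|) <=
  mean (fun s : 'S_n => `|resid (s p') (s q')|) + 2^-1 * mean (fun s : 'S_n => `|h (s p')|)
  + 2^-1 * mean (fun s : 'S_n => `|h (s q')|)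
  + 2^-1 * mean (fun s : 'S_n => `|degM w (s p') (s q') / n%:R|).
  rewrite -!meanZ -!meanD; apply: le_mean => s.
  have -> : w (s p') (s q') = resid (s p') (s q') + 2^-1 * h (s p') + 2^-1 * h (s q')
      + 2^-1 * (degM w (s p') (s q') / n%:R).
    rewrite /resid (inj_eq (@perm_inj _ s)) (negbTE pq') /h /degM /outpot /inpot.
    by field; rewrite n_neq0 n2_neq0.
  have i2 : 2^-1 = `|2^-1| :> R by rewrite ger0_norm ?invr_ge0.
  by rewrite {4 5 6}i2 -!normrM; do 3![apply: le_trans (ler_normD _ _) _; apply: lerD => //].
rewrite H1 meanD.
have : 0 <= mean (fun s : 'S_n => `|degM w (s p') (s q') / n%:R|) by apply: mean_ge0.
move: H2 H3 H3' H4; clear.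
move: (mean _) (mean _) (mean _) (mean _) (mean _) (mean _) (mean _) => a b c d e f g; lra.
Qed.

End Residual.

(** * Three random planar vectors *)

Lemma mean_abs_prod (R : realType) (T U : finType) (F : T -> R) (G : U -> R) :
  mean (fun x : T * U => `|F x.1 * G x.2|) = mean (fun x => `|F x|) * mean (fun x => `|G x|).
Proof. by rewrite -mean_prod; apply: eq_mean => x; rewrite normrM. Qed.

Lemma mean_lt_exists (R : realType) (T : finType) (F G : T -> R) :
  mean F < mean G -> exists x, F x < G x.
Proof.
move=> FG; apply/existsP; apply: contraLR FG; rewrite negb_exists -leNgt => /forallP H.
by apply: le_mean => x; have := H x; rewrite -leNgt.
Qed.

(* A vector (p, m) nearly orthogonal to both of the last two random planar vectors forces
   them to be nearly parallel, by the identity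
   (p^2 + l m^2)(P P' + l M M') = (p P + l m M)(p P' + l m M') + l (p M - m P)(p M' - m P'). *)
Lemma three_planar_vectors (R : realType) (T : finType) (l : R) (P1 M1 P2 M2 P3 M3 : T -> R) :
  2^-1 <= l <= 1 ->
  2 / 5 <= mean (fun x => `|P1 x| + `|M1 x|) ->
  2 / 5 <= mean (fun x => `|P2 x| + `|M2 x|) ->
  2 / 5 <= mean (fun x => `|P3 x| + `|M3 x|) ->
  [\/ 500^-1 <= mean (fun x : T * T => `|P1 x.1 * P2 x.2 + l * (M1 x.1 * M2 x.2)|),
      500^-1 <= mean (fun x : T * T => `|P1 x.1 * P3 x.2 + l * (M1 x.1 * M3 x.2)|) |
      500^-1 <= mean (fun x : T * T => `|P2 x.1 * P3 x.2 + l * (M2 x.1 * M3 x.2)|)].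
Proof.
move=> /andP[l2 l1] V1 V2 V3.
pose N (P M : T -> R) a b := mean (fun x => `|a * P x + l * (b * M x)|).
have [|e12] := lerP 500^-1 (mean (fun x : T * T => `|P1 x.1 * P2 x.2 + l * (M1 x.1 * M2 x.2)|)).
  by constructor 1.
have [|e13] := lerP 500^-1 (mean (fun x : T * T => `|P1 x.1 * P3 x.2 + l * (M1 x.1 * M3 x.2)|)).
  by constructor 2.
have [|e23] := lerP 500^-1 (mean (fun x : T * T => `|P2 x.1 * P3 x.2 + l * (M2 x.1 * M3 x.2)|)).
  by constructor 3.
exfalso.
move: e12 e13.
rewrite (mean_pair (fun x y => `|P1 x * P2 y + l * (M1 x * M2 y)|)).
rewrite (mean_pair (fun x y => `|P1 x * P3 y + l * (M1 x * M3 y)|)) => e12 e13.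
(* Fix a value of the first vector nearly orthogonal to both others, relative to its size. It exists
   on average since 2/500 = (2/5)/100. *)
have [x] : exists x, N P2 M2 (P1 x) (M1 x) + N P3 M3 (P1 x) (M1 x) < 100^-1 * (`|P1 x| + `|M1 x|).
  apply: mean_lt_exists; rewrite meanD meanZ.
  have {}e12 : mean (fun x => N P2 M2 (P1 x) (M1 x)) < 500^-1 := e12.
  have {}e13 : mean (fun x => N P3 M3 (P1 x) (M1 x)) < 500^-1 := e13.
  move: (mean _) (mean _) (mean _) V1 e12 e13 => a b c; lra.
move: (P1 x) (M1 x) => p m; set k := `|p| + `|m| => Nk.
have N0 P M : 0 <= N P M p m by apply: mean_ge0.
have k0 : 0 < k by have := N0 P2 M2; have := N0 P3 M3; lra.
pose D := p ^+ 2 + l * m ^+ 2.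
have p2 : p ^+ 2 = `|p| ^+ 2 by rewrite real_normK ?num_real.
have m2 : m ^+ 2 = `|m| ^+ 2 by rewrite real_normK ?num_real.
have m20 := sqr_ge0 m.
have Dk : k ^+ 2 / 4 <= D.
  have : 2^-1 * m ^+ 2 <= l * m ^+ 2 by rewrite ler_wpM2r.
  have := sqr_ge0 (`|p| - `|m|); have := sqr_ge0 `|p|.
  by rewrite /D /k p2 m2 !expr2; lra.
have Dk' : D <= k ^+ 2.
  have : l * m ^+ 2 <= m ^+ 2 by rewrite ler_piMl.
  have : 0 <= `|p| * `|m| by rewrite mulr_ge0.
  by rewrite /D /k p2 m2 !expr2; lra.
have D0 : 0 <= D by rewrite (le_trans _ Dk)// divr_ge0// sqr_ge0.
have l0 : 0 <= l by lra.
(* The determinant with (p, m). As (P, M) is recovered from its product and its determinant with (p,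
   m), a small product forces a large determinant: k^2/10 - k^2/100 gives the 9/100 below. *)
pose W (P M : T -> R) := mean (fun x => `|p * M x - m * P x|).
have W_ge P M : 2 / 5 <= mean (fun x => `|P x| + `|M x|) ->
    N P M p m <= 100^-1 * k -> 9 / 100 * k <= W P M.
  move=> V NPM.
  have : D * mean (fun x => `|P x| + `|M x|) <= k * N P M p m + k * W P M.
    rewrite -!meanZ -meanD; apply: le_mean => y.
    set a := p * P y + l * (m * M y); set b := p * M y - m * P y.
    rewrite mulrDr -{1 2}(ger0_norm D0) -!normrM.
    have -> : D * P y = p * a - l * (m * b) by rewrite /D /a /b; ring.
    have -> : D * M y = m * a + p * b by rewrite /D /a /b; ring.
    have h1 := ler_normB (p * a) (l * (m * b)).
    have h2 := ler_normD (m * a) (p * b).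
      move: h1 h2; rewrite !normrM (ger0_norm l0) /k.
    have : l * (`|m| * `|b|) <= `|m| * `|b|.
      by rewrite ler_piMl// mulr_ge0.
    by rewrite !mulrDl; lra.
  have : D * (2 / 5) <= D * mean (fun x => `|P x| + `|M x|) by rewrite ler_wpM2l.
  have : k * N P M p m <= k * (100^-1 * k) by rewrite ler_wpM2l// ltW.
  move=> h1 h2 h3; rewrite -(ler_pM2l k0); nra.
have W2 : 9 / 100 * k <= W P2 M2 by apply: W_ge => //; have := N0 P3 M3; lra.
have W3 : 9 / 100 * k <= W P3 M3 by apply: W_ge => //; have := N0 P2 M2; lra.
have : l * (W P2 M2 * W P3 M3) <= D * 500^-1 + N P2 M2 p m * N P3 M3 p m.
  apply: (@le_trans _ _ (D * mean (fun x : T * T => `|P2 x.1 * P3 x.2 + l * (M2 x.1 * M3 x.2)|)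
     + N P2 M2 p m * N P3 M3 p m)); last first.
    by rewrite lerD2r ler_wpM2l ?(ltW e23).
  rewrite -!mean_abs_prod -!meanZ -meanD; apply: le_mean => y.
  rewrite -{1}(ger0_norm l0) -{1}(ger0_norm D0) -!normrM.
  apply: le_trans (ler_normB _ _); rewrite le_eqVlt; apply/orP; left; apply/eqP; congr `|_|.
  by rewrite /D; ring.
have WW : (9 / 100 * k) * (9 / 100 * k) <= W P2 M2 * W P3 M3.
  by rewrite ler_pM//; lra.
have NN : N P2 M2 p m * N P3 M3 p m <= (100^-1 * k) * (100^-1 * k).
  by rewrite ler_pM//; have := N0 P3 M3; have := N0 P2 M2; lra.
(* The contradiction is 0.00405 k^2 against k^2/500 + k^2/10000 = 0.0021 k^2. *)
have : 2^-1 * ((9 / 100 * k) * (9 / 100 * k)) <= l * (W P2 M2 * W P3 M3).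
  by rewrite ler_pM//; nra.
have kk : 0 < k * k by rewrite mulr_gt0.
rewrite expr2 in Dk'; lra.
Qed.

(** * Lower bounds for the discrepancies *)

Lemma exists_blocks (m n : nat) : (4 * m <= n)%N ->
  exists pos : 'I_m * (bool * bool) -> 'I_n, injective pos.
Proof.
move=> mn; have le : (#|{: 'I_m * (bool * bool)}| <= n)%N.
  by rewrite !card_prod card_ord card_bool mulnC.
by exists (widen_ord le \o enum_rank) => x y [] /val_inj /enum_rank_inj.
Qed.

Section Offdiag.
Variables (R : realType) (n : nat).
Implicit Types (w u : wdigraph R n).

(** Diagonal values of a [wdigraph] are arbitrary; setting them to zero lets all sums run over full
    rows and columns. *)
Definition offdiag w : wdigraph R n := fun x y => if x == y then 0 else w x y.

Lemma offdiag_diag w x : offdiag w x x = 0.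
Proof. by rewrite /offdiag eqxx. Qed.

Lemma sum_offdiag w x (F : R -> R) : F 0 = 0 ->
  \sum_y F (offdiag w x y) = \sum_(y | x != y) F (w x y).
Proof.
move=> F0; rewrite [RHS]big_mkcond; apply: eq_bigr => y _.
by rewrite /offdiag; case: eqP.
Qed.

Lemma wd_total_offdiag w : wd_total (offdiag w) = wd_total w.
Proof.
apply: eq_bigr => x _; apply: eq_bigr => y xy.
by rewrite /offdiag (negbTE xy).
Qed.

Lemma wd_norm1_offdiag w : wd_norm1 (offdiag w) = wd_norm1 w.
Proof.
apply: eq_bigr => x _; apply: eq_bigr => y xy.
by rewrite /offdiag (negbTE xy).
Qed.

Lemma sum_outdeg_offdiag w : \sum_x outdeg (offdiag w) x = wd_total w.
Proof. by apply: eq_bigr => x _; rewrite /outdeg (sum_offdiag w x (F := id)). Qed.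

(** Only the relative permutation matters, so relabelling both graphs produces no new values, yet
    makes the positions exchangeable. *)
Lemma gain_offdiag w u (x : 'S_n * 'S_n) : gain (offdiag w) (offdiag u) x =
  wd_inner (wd_relabel w (x.2^-1 * x.1)^-1%g) u.
Proof.
rewrite /gain /wsum /wd_inner [RHS](reindex_inj (@perm_inj _ x.2)).
apply: eq_bigr => a _; rewrite [RHS](reindex_inj (@perm_inj _ x.2)) [RHS]big_mkcond/=.
apply: eq_bigr => b _; rewrite /pull /offdiag /wd_relabel invgK !permM !permK.
by rewrite !(inj_eq (@perm_inj _ _)); case: (a == b) => //=; rewrite mul0r.
Qed.

Lemma gain_bounds w u x : wd_total w = 0 ->
  - disc_minus w u <= gain (offdiag w) (offdiag u) x <= disc_plus w u.
Proof.
move=> w0; rewrite gain_offdiag /disc_minus /disc_plus /wd_density w0 !mul0r subr0 sub0r opprK.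
by rewrite /wd_min_inner /wd_max_inner bigmin_le_cond// le_bigmax_cond.
Qed.

Lemma mean_gain0 w u : (1 < n)%N -> (forall x, w x x = 0) -> wd_total w = 0 ->
  mean (gain w u) = 0.
Proof.
move=> n1 w0 wt; rewrite /gain /wsum mean_sum big1// => x _.
rewrite mean_sum big1// => y _.
rewrite (mean_prod (fun s : 'S_n => w (s x) (s y)) (fun t : 'S_n => u (t x) (t y))).
have [->|xy] := eqVneq x y.
  by rewrite /mean big1 ?mul0r// => s _; rewrite w0.
suff -> : mean (fun s : 'S_n => w (s x) (s y)) = 0 by rewrite mul0r.
have nn : n%:R * (n%:R - 1) != 0 :> R.
  have : 2 <= n%:R :> R by rewrite ler_nat.
  by move=> n2; rewrite mulf_neq0// gt_eqF//; lra.
by apply: (mulfI nn); rewrite mean_off// wt mulr0.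
Qed.

Lemma disc_product_ge w u (m : nat) (p q : 'I_m -> 'I_n)
  (phi : 'I_m -> 'S_n * 'S_n -> R) (B : R) :
  (1 < n)%N -> wd_total w = 0 ->
  (forall i j, p i = p j -> i = j) -> (forall i j, q i = q j -> i = j) ->
  (forall i j, p i <> q j) ->
  (forall i x, `|phi i x| <= 1) ->
  (forall i x, phi i (lmul1 (tperm (p i) (q i)) x) = - phi i x) ->
  (forall i j x, i != j -> phi j (lmul1 (tperm (p i) (q i)) x) = phi j x) ->
  0 <= B ->
  (forall i, B <= mean (fun x => gain (offdiag w) (offdiag u) x * phi i x)) ->
  (m%:R * B) ^+ 2 / 4 <= disc_plus w u * disc_minus w u.
Proof.
move=> n1 wt p_inj q_inj pq phi1 phi_odd phi_inv B0 phiB.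
pose X (k : 'I_n * 'I_n) (x : 'S_n * 'S_n) : R :=
  pull (offdiag w) x.1 k.1 k.2 * pull (offdiag u) x.2 k.1 k.2.
have XE x : \sum_k X k x = gain (offdiag w) (offdiag u) x.
  by rewrite /gain /wsum pair_bigA.
have mB : m%:R * B <= \sum_i mean (fun x => (\sum_k X k x) * phi i x).
  rewrite mulr_natl -[X in B *+ X]card_ord -sumr_const; apply: ler_sum => i _.
  by rewrite (eq_mean (fun x => congr1 ( *%R^~ (phi i x)) (XE x))).
have mB0 : 0 <= m%:R * B by rewrite mulr_ge0.
apply: (@le_trans _ _ ((\sum_i mean (fun x => (\sum_k X k x) * phi i x)) ^+ 2 / 4)).
  by rewrite ler_pM2r ?invr_gt0// lerXn2r ?nnegrE// (le_trans mB0).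
apply: (@riesz_product _ _ _ _ (fun i => lmul1 (tperm (p i) (q i)))) => //.
- by rewrite card_prod muln_gt0 card_perm_gt0.
- by move=> i; apply: lmul1_inj.
- move=> [a b] I I2.
  pose t i c := (c == p i) || (c == q i).
  have t_inj i j c : t i c -> t j c -> i = j.
    by rewrite /t => /orP[] /eqP -> /orP[] /eqP e;
      [exact: p_inj|case: (pq _ _ e)|case: (pq _ _ (esym e))|exact: q_inj].
  (* Pigeonhole: each of the positions a and b is moved by at most one of the disjoint
     transpositions, so one of any three fixes both. *)
  have [i iI tab] : exists2 i, i \in I & ~~ t i a && ~~ t i b.
    have /card_gt2P [x [y [z [[xI yI zI] [xy yz zx]]]]] := I2.
    case tx : (t x a || t x b); last by exists x; rewrite -?negb_or ?tx.
    case ty : (t y a || t y b); last by exists y; rewrite -?negb_or ?ty.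
    case tz : (t z a || t z b); last by exists z; rewrite -?negb_or ?tz.
    case/orP: tx => tx; case/orP: ty => ty; case/orP: tz => tz;
    solve [ by move: xy; rewrite (t_inj _ _ _ tx ty) eqxx
          | by move: yz; rewrite (t_inj _ _ _ ty tz) eqxx
          | by move: zx; rewrite (t_inj _ _ _ tz tx) eqxx ].
  exists i => // x; move: tab; rewrite /t !negb_or => /andP[/andP[ap aq] /andP[bp bq]].
  by rewrite /X/= pullM /pull !tpermD// eq_sym.
- by rewrite (eq_mean XE) mean_gain0 ?wd_total_offdiag//; apply: offdiag_diag.
- by move=> x; rewrite XE gain_bounds.
- exact: le_trans mB.
Qed.

End Offdiag.

Section Bounds.
Variables (R : realType) (n m : nat) (pos : 'I_m * (bool * bool) -> 'I_n).
Hypothesis pos_inj : injective pos.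
Hypothesis n4 : (4 <= n)%N.
Hypothesis mn : (m <= n)%N.
Variables (a b c d : 'I_n).
Hypothesis abcd : uniq [:: a; b; c; d].
Implicit Types w u : wdigraph R n.

(** The first boolean of a block separates the positions swapped by the i-th transposition from a
    pair to be flipped. *)
Let p i := pos (i, (false, false)).
Let q i := pos (i, (false, true)).
Let f (kb : 'I_m * bool) := pos (kb.1, (true, kb.2)).

Let p_inj i j : p i = p j -> i = j. Proof. by move=> /pos_inj[]. Qed.
Let q_inj i j : q i = q j -> i = j. Proof. by move=> /pos_inj[]. Qed.
Let f_inj : injective f. Proof. by move=> [k b1] [l b2] /pos_inj[-> ->]. Qed.
Let pq i j : p i <> q j. Proof. by move=> /pos_inj. Qed.
Let fp kb i : f kb != p i. Proof. by apply/eqP => /pos_inj. Qed.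
Let fq kb i : f kb != q i. Proof. by apply/eqP => /pos_inj. Qed.
Let pq' i j : p i != q j. Proof. by apply/eqP; apply: pq. Qed.

Definition symmean w : R := mean (fun s : 'S_n => `|sym4 (pull (offdiag w) s) a b c d|).
Definition asymmean w : R := mean (fun s : 'S_n => `|asym4 (pull (offdiag w) s) a b c d|).
Definition outmean w : R := mean (fun s : 'S_n => `|out4 (pull (offdiag w) s) a b c d|).
Definition nP w (s : 'S_n) : R := degP (offdiag w) (s a) (s b) / n%:R.
Definition nM w (s : 'S_n) : R := degM (offdiag w) (s a) (s b) / n%:R.
Definition stdmean w u : R := mean (fun x : 'S_n * 'S_n =>
  `|nP w x.1 * nP u x.2 + (n%:R - 2) / n%:R * (nM w x.1 * nM u x.2)|).

Let sqrt_m2 : Num.sqrt m%:R * Num.sqrt m%:R = m%:R :> R.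
Proof. by rewrite -expr2 sqr_sqrtr. Qed.

(** Here [phi i] is the sign of [corrsum] at [p i], [q i]. All i share the same flipped pairs, which
    the transpositions never touch. The 16 is 4 from the mean of |corrsum| times 4 from
    [mean_gain_corr]. *)
Lemma disc_product_corr w u (D : R) : wd_total w = 0 -> 0 <= D ->
  D <= symmean w * symmean u \/ D <= asymmean w * asymmean u ->
  (m%:R * (Num.sqrt m%:R * D / 16)) ^+ 2 / 4 <= disc_plus w u * disc_minus w u.
Proof.
move=> wt D0 hD.
pose Z i := corrsum (offdiag w) (offdiag u) (p i) (q i) f.
have Z_ge i : Num.sqrt m%:R * D / 4 <= mean (fun x => `|Z i x|).
  have := mean_corrsum (offdiag w) (offdiag u) f_inj (fun kb => fp kb i) (fun kb => fq kb i).
  have : m%:R * (D / 2) <= \sum_k mean (fun x =>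
      `|gain4 (offdiag w) (offdiag u) (p i) (q i) (f (k, false)) (f (k, true)) x|).
    rewrite mulr_natl -[X in _ *+ X]card_ord -sumr_const; apply: ler_sum => k _.
    have uk : uniq [:: p i; q i; f (k, false); f (k, true)].
      rewrite /= !inE !negb_or pq' !andbT ![p i == f _]eq_sym ![q i == f _]eq_sym !fp !fq/=.
      by apply/eqP => /f_inj.
    have [] := mean_gain4 (offdiag w) (offdiag u) uk.
    have e (W : wdigraph R n) :
        (mean (fun s : 'S_n => `|sym4 (pull W s) (p i) (q i) (f (k, false)) (f (k, true))|) =
         mean (fun s : 'S_n => `|sym4 (pull W s) a b c d|)) *
        (mean (fun s : 'S_n => `|asym4 (pull W s) (p i) (q i) (f (k, false)) (f (k, true))|) =
         mean (fun s : 'S_n => `|asym4 (pull W s) a b c d|)).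
      pose o (l : seq 'I_n) : R := W (nth a l 0) (nth a l 2) - W (nth a l 1) (nth a l 2)
        - W (nth a l 0) (nth a l 3) + W (nth a l 1) (nth a l 3).
      pose o' (l : seq 'I_n) : R := W (nth a l 2) (nth a l 0) - W (nth a l 2) (nth a l 1)
        - W (nth a l 3) (nth a l 0) + W (nth a l 3) (nth a l 1).
      split; first exact: (mean_pos (fun l => `|o l + o' l|) uk abcd).
      exact: (mean_pos (fun l => `|o l - o' l|) uk abcd).
    rewrite !e -/(symmean w) -/(symmean u) -/(asymmean w) -/(asymmean u).
    by case: hD; lra.
  have [m0|m0] := posnP m.
    have -> : Num.sqrt m%:R = 0 :> R by rewrite m0 sqrtr0.
    by move=> _ _; rewrite !mul0r mean_ge0.
  have s0 : 0 < Num.sqrt m%:R :> R by rewrite sqrtr_gt0 ltr0n.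
  move=> h1 h2; have := le_trans h1 h2; rewrite -/(Z i) -[X in X * (D / 2)]sqrt_m2 => h.
  by rewrite -(ler_pM2l s0); lra.
apply: (@disc_product_ge _ _ w u m p q (fun i x => Num.sg (Z i x))) => //.
- by rewrite (leq_trans _ n4).
- by move=> i x; rewrite normr_sg; case: eqP.
- by move=> i x; rewrite /Z corrsum_swap ?sgrN// => kb; rewrite ?fp ?fq.
- move=> i j x ij; congr Num.sg; rewrite /Z /corrsum; apply: eq_bigr => k _.
  have pji : (p i != p j) * (q i != q j).
    by split; apply: contraNneq ij => /pos_inj[->].
  by rewrite /gain4/= pullM corr4_fix// tpermD// ?pji// eq_sym ?fp ?fq ?pq'.
- by rewrite !mulr_ge0// ?sqrtr_ge0 ?invr_ge0.
- move=> i; rewrite mean_gain_corr//; last exact: offdiag_diag.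
  by have := Z_ge i; rewrite /Z; move: (mean _) => t; lra.
Qed.

(** Here [phi i] is the sign of [stdgain], which depends only on the labels at [p i] and [q i]. *)
Lemma disc_product_std w u : wd_total w = 0 -> wd_total u = 0 ->
  outmean w <= 50^-1 -> outmean u <= 50^-1 -> 500^-1 <= stdmean w u ->
  (m%:R * (Num.sqrt m%:R * 50^-1 ^+ 2 / 16)) ^+ 2 / 4 <= disc_plus w u * disc_minus w u.
Proof.
move=> wt ut ow ou wu.
have n4R : 4 <= n%:R :> R by rewrite ler_nat.
have n0 : n%:R != 0 :> R by rewrite gt_eqF//; lra.
have n20 : 0 < n%:R - 2 :> R by lra.
have ab : a != b by move: abcd; rewrite /= !inE !negb_or -!andbA => /and5P[].
pose K i (x : 'S_n * 'S_n) := stdgain (pull (offdiag w) x.1) (pull (offdiag u) x.2) (p i) (q i).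
pose V (x y x' y' : 'I_n) : R :=
  degP (offdiag w) x y / n%:R * (degP (offdiag u) x' y' / n%:R)
  + (n%:R - 2) / n%:R * (degM (offdiag w) x y / n%:R * (degM (offdiag u) x' y' / n%:R)).
pose S (x y x' y' : 'I_n) : R := skewr (offdiag w) x y * skewr (offdiag u) x' y'.
pose at_ i (G : 'I_n -> 'I_n -> 'I_n -> 'I_n -> R) (x : 'S_n * 'S_n) : R :=
  G (x.1 (p i)) (x.1 (q i)) (x.2 (p i)) (x.2 (q i)).
have KE i x : K i x = n%:R / (2 * (n%:R - 2)) * (n%:R * at_ i V x + 2 * at_ i S x).
  rewrite /K /stdgain /at_ /V /S !degP_pull !degM_pull !skewr_pull; field.
  by rewrite n0 gt_eqF.
have K_odd i x : K i (lmul1 (tperm (p i) (q i)) x) = - K i x.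
  rewrite !KE /at_ /V /S /= !permM tpermL tpermR.
  by rewrite /skewr /degP /degM /skewpart; ring.
have K_ge i : Num.sqrt m%:R * 50^-1 ^+ 2 / 8 <= mean (fun x => `|K i x|).
  have e : mean (fun x => `|at_ i V x|) = stdmean w u.
    apply: (@mean_pos2 R n (fun l l' => `|V (nth a l 0) (nth a l 1) (nth a l' 0) (nth a l' 1)|)
      [:: p i; q i] [:: a; b]) => //=; by rewrite inE andbT.
  have C v : wd_total v = 0 -> outmean v <= 50^-1 ->
     mean (fun s : 'S_n => `|skewr (offdiag v) (s (p i)) (s (q i))|) <= 25^-1.
    move=> vt ov; apply: le_trans (@mean_skewr _ _ (offdiag v) n4 _ _ _ _ _ _ _ _ abcd _) _ => //.
    - exact: offdiag_diag.
    - by rewrite sum_outdeg_offdiag.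
    - by rewrite -/(outmean v); lra.
  have CC : mean (fun x => `|at_ i S x|) <= 25^-1 * 25^-1.
    rewrite (mean_abs_prod (fun s : 'S_n => skewr (offdiag w) (s (p i)) (s (q i)))
      (fun s : 'S_n => skewr (offdiag u) (s (p i)) (s (q i)))).
    by rewrite ler_pM// ?C//; apply: mean_ge0.
  have k0 : 2^-1 <= n%:R / (2 * (n%:R - 2)) :> R.
    by rewrite ler_pdivlMr; [lra|rewrite pmulr_rgt0].
  (* The degree part has order n, and already at n = 4 its 4/500 = 5/625 exceeds the skew error
     2/625. *)
  have main : n%:R * 500^-1 - 2 * (25^-1 * 25^-1) <= mean (fun x => `|K i x|) * 2.
    apply: (@le_trans _ _ (2 * (2^-1 * (n%:R * stdmean w u - 2 * mean (fun x => `|at_ i S x|))))).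
      have : n%:R * 500^-1 <= n%:R * stdmean w u by rewrite ler_wpM2l.
      by move: CC; move: (mean _) => t; lra.
    rewrite [leRHS]mulrC ler_wpM2l// -e -!meanZ -meanB -meanZ; apply: le_mean => x.
    rewrite KE; set A := at_ i V x; set B := at_ i S x.
    apply: (@le_trans _ _ (2^-1 * `|n%:R * A + 2 * B|)).
      rewrite ler_wpM2l ?invr_ge0//.
      have := lerB_dist (n%:R * A) (- (2 * B)).
      rewrite opprK normrN !normrM (@ger0_norm _ n%:R) ?ler0n// (@ger0_norm _ 2)//; lra.
    by rewrite normrM ler_wpM2r// ger0_norm// (le_trans _ k0)// invr_ge0.
  (* The bound of order n is weakened to order sqrt m, to match [disc_product_corr] with D =
     1/2500. *)
  have sm : Num.sqrt m%:R <= n%:R :> R.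
    apply: (@le_trans _ _ m%:R); last by rewrite ler_nat.
    have [m0|m0] := posnP m; first by rewrite [X in X%:R]m0 sqrtr0.
    rewrite -[leRHS]sqrt_m2 ler_peMl ?sqrtr_ge0// -{1}sqrtr1 ler_sqrt ?ler1n//.
  by move: main; move: (mean _) => t; lra.
apply: (@disc_product_ge _ _ w u m p q (fun i x => Num.sg (K i x))) => //.
- by rewrite (leq_trans _ n4).
- by move=> i x; rewrite normr_sg; case: eqP.
- by move=> i x; rewrite K_odd sgrN.
- move=> i j x ij; congr Num.sg; rewrite !KE /at_ /= !permM !tpermD ?pq'// 1?eq_sym ?pq'//;
    by apply: contraNneq ij => /pos_inj[->].
- by rewrite !mulr_ge0// ?sqrtr_ge0 ?invr_ge0.
- move=> i; rewrite (@mean_gain_std _ _ _ _ _ _ (p i) (q i))//.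
  + rewrite (@eq_mean _ _ _ (fun x => `|K i x|)); last by move=> x; rewrite mulrC -normrEsg.
    by have := K_ge i; move: (mean _) => t; lra.
  + exact: offdiag_diag.
  + exact: offdiag_diag.
  + by move=> x; rewrite K_odd sgrN.
  + by rewrite (leq_trans _ n4).
  + move=> x z z' zp zq zp' zq'; rewrite !KE /at_ /= !permM !tpermD//.
Qed.

End Bounds.

(** * Choosing two of the five graphs *)

Section Pairs.
Variables (R : realType) (n m : nat) (a b c d : 'I_n).
Hypothesis n4 : (4 <= n)%N.
Hypothesis abcd : uniq [:: a; b; c; d].
Implicit Types w u : wdigraph R n.

Lemma stdmean_sym w u : stdmean a b w u = stdmean a b u w.
Proof.
rewrite /stdmean (mean_swap (fun s t => `|nP a b w s * nP a b u t +
  (n%:R - 2) / n%:R * (nM a b w s * nM a b u t)|)); apply: eq_mean => x.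
by rewrite [_ * nP _ _ _ _]mulrC [_ * nM _ _ _ _]mulrC.
Qed.

Lemma outmean_le w : outmean a b c d w <= (symmean a b c d w + asymmean a b c d w) / 2.
Proof.
rewrite mulrC -meanD -meanZ; apply: le_mean => s.
have -> : out4 (pull (offdiag w) s) a b c d =
  2^-1 * (sym4 (pull (offdiag w) s) a b c d + asym4 (pull (offdiag w) s) a b c d).
  by rewrite /sym4 /asym4; field.
by rewrite normrM ger0_norm ?invr_ge0// ler_wpM2l ?invr_ge0// ler_normD.
Qed.

Lemma std_pair w1 w2 w3 :
  wd_total w1 = 0 -> wd_total w2 = 0 -> wd_total w3 = 0 ->
  wd_norm1 w1 = n%:R * (n%:R - 1) -> wd_norm1 w2 = n%:R * (n%:R - 1) ->
  wd_norm1 w3 = n%:R * (n%:R - 1) ->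
  outmean a b c d w1 <= 50^-1 -> outmean a b c d w2 <= 50^-1 -> outmean a b c d w3 <= 50^-1 ->
  [\/ 500^-1 <= stdmean a b w1 w2, 500^-1 <= stdmean a b w1 w3 | 500^-1 <= stdmean a b w2 w3].
Proof.
have ab : a != b by move: abcd; rewrite /= !inE !negb_or -!andbA => /and5P[].
have n4R : 4 <= n%:R :> R by rewrite ler_nat.
have V w : wd_total w = 0 -> wd_norm1 w = n%:R * (n%:R - 1) -> outmean a b c d w <= 50^-1 ->
   2 / 5 <= mean (fun s => `|nP a b w s| + `|nM a b w s|).
  move=> wt wn ow; have := @mean_deg_ge _ _ (offdiag w) n4 _ _ _ _ _ _ _ _ abcd ab _.
  rewrite sum_outdeg_offdiag wd_norm1_offdiag => /(_ (offdiag_diag w) wt wn).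
  rewrite -/(outmean a b c d w) -/(nP a b w) -/(nM a b w); apply: le_trans; lra.
move=> *; apply: three_planar_vectors; rewrite ?V//.
by rewrite ler_pdivlMr ?ler_pdivrMr; lra.
Qed.

(** The 32^2 is 16^2 * 4, and 8^3 is the price of replacing m by n. *)
Lemma disc_constant : (n <= 8 * m)%N ->
  50^-1 ^+ 4 / (8 ^+ 3 * 32 ^+ 2) * n%:R ^+ 3 <=
  (m%:R * (Num.sqrt m%:R * 50^-1 ^+ 2 / 16)) ^+ 2 / 4 :> R.
Proof.
move=> nm; have nmR : n%:R <= 8 * m%:R :> R by rewrite -natrM ler_nat.
have -> : (m%:R * (Num.sqrt m%:R * 50^-1 ^+ 2 / 16)) ^+ 2 / 4 =
   50^-1 ^+ 4 / (8 ^+ 3 * 32 ^+ 2) * (8 * m%:R) ^+ 3 :> R.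
  have : Num.sqrt m%:R ^+ 2 = m%:R :> R by rewrite sqr_sqrtr.
  move: (Num.sqrt _) => s sm; by rewrite -sm; field.
rewrite ler_wpM2l ?divr_ge0 ?mulr_ge0 ?exprn_ge0 ?invr_ge0//.
by rewrite lerXn2r ?nnegrE ?mulr_ge0.
Qed.

End Pairs.

(** Both orders of the pair are covered, so that the bound on [disc] can later be stated for i <
    j. *)
Lemma exists_pair (R : realType) (n : nat) (w : 'I_5 -> wdigraph R n) :
  (4 <= n)%N -> (forall i, wd_total (w i) = 0) ->
  (forall i, wd_norm1 (w i) = n%:R * (n%:R - 1)) ->
  exists i j : 'I_5, i != j /\ forall k l, (k, l) \in [:: (i, j); (j, i)] ->
    50^-1 ^+ 4 / (8 ^+ 3 * 32 ^+ 2) * n%:R ^+ 3 <= disc_plus (w k) (w l) * disc_minus (w k) (w l).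
Proof.
move=> n4 wt w1; pose m := (n %/ 4)%N.
have [pos pos_inj] : exists pos : 'I_m * (bool * bool) -> 'I_n, injective pos.
  by apply: exists_blocks; rewrite /m; lia.
have m0 : (0 < m)%N by rewrite /m; lia.
have mn : (m <= n)%N by rewrite /m; lia.
have nm : (n <= 8 * m)%N by rewrite /m; lia.
pose P e := pos (Ordinal m0, e).
pose a := P (false, false); pose b := P (false, true).
pose c := P (true, false); pose d := P (true, true).
have abcd : uniq [:: a; b; c; d].
  by rewrite /= !inE !negb_or !(inj_eq pos_inj).
have le_c := le_trans (disc_constant R nm).
pose A := [set i | 50^-1 <= symmean a b c d (w i)].
pose B := [set i | 50^-1 <= asymmean a b c d (w i)].
have sq x y : 50^-1 <= x -> 50^-1 <= y -> 50^-1 ^+ 2 <= x * y :> R.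
  by move=> *; rewrite expr2 ler_pM ?invr_ge0.
have [A2|A1] := ltnP 1 #|A|.
  have /card_gt1P[i [j [iA jA ij]]] := A2; rewrite !inE in iA jA.
  exists i, j; split => // k l; rewrite !inE => kl; apply: le_c.
  apply: (disc_product_corr pos_inj n4 abcd) => //; first by rewrite exprn_ge0 ?invr_ge0.
  by left; case/orP: kl => /eqP[-> ->]; apply: sq.
have [B2|B1] := ltnP 1 #|B|.
  have /card_gt1P[i [j [iB jB ij]]] := B2; rewrite !inE in iB jB.
  exists i, j; split => // k l; rewrite !inE => kl; apply: le_c.
  apply: (disc_product_corr pos_inj n4 abcd) => //; first by rewrite exprn_ge0 ?invr_ge0.
  by right; case/orP: kl => /eqP[-> ->]; apply: sq.
(* At most one graph has a large symmetric part and at most one a large antisymmetric part, so three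
   of the five have neither. *)
have C2 : (2 < #|~: (A :|: B)|)%N.
  have [AB _] := leq_card_setU A B; have := cardsC (A :|: B).
  by move: AB A1 B1; rewrite card_ord; move: #|_| #|_| #|_| #|_| => x y z t; lia.
have /card_gt2P[i [j [k [[iC jC kC] [ij jk ki]]]]] := C2.
have oC x : x \in ~: (A :|: B) -> outmean a b c d (w x) <= 50^-1.
  rewrite !inE negb_or -!ltNge => /andP[h1 h2].
  by apply: le_trans (outmean_le a b c d (w x)) _; lra.
have std x y : x \in ~: (A :|: B) -> y \in ~: (A :|: B) -> 500^-1 <= stdmean a b (w x) (w y) ->
  forall k l, (k, l) \in [:: (x, y); (y, x)] ->
  50^-1 ^+ 4 / (8 ^+ 3 * 32 ^+ 2) * n%:R ^+ 3 <= disc_plus (w k) (w l) * disc_minus (w k) (w l).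
  move=> xC yC xy k' l; rewrite !inE => kl; apply: le_c.
  by case/orP: kl => /eqP[-> ->]; apply: (disc_product_std pos_inj n4 mn abcd);
    rewrite ?oC// stdmean_sym.
have [h|h|h] := std_pair n4 abcd (wt i) (wt j) (wt k)
  (w1 i) (w1 j) (w1 k) (oC _ iC) (oC _ jC) (oC _ kC).
- by exists i, j; split => //; apply: std.
- by exists i, k; split; [rewrite eq_sym|apply: std].
- by exists j, k; split => //; apply: std.
Qed.

Theorem theorem1p6 (R : realType) :
  exists c c' : R, [/\ 0 < c, 0 < c' &
    forall (n : nat) (w : 'I_5 -> wdigraph R n),
      (4 <= n)%N ->
      (forall i : 'I_5, wd_total (w i) = 0) ->
      (forall i : 'I_5, wd_norm1 (w i) = n%:R * (n%:R - 1)) ->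
      (exists i j : 'I_5,
         i != j /\
         c * n%:R ^+ 3 <= disc_plus (w i) (w j) * disc_minus (w i) (w j)) /\
      (exists i j : 'I_5,
         (i < j)%N /\ c' * (n%:R `^ (3 / 2)) <= disc (w i) (w j))].
Proof.
pose c : R := 50^-1 ^+ 4 / (8 ^+ 3 * 32 ^+ 2).
have c0 : 0 < c by rewrite divr_gt0 ?exprn_gt0 ?invr_gt0// mulr_gt0 ?exprn_gt0.
exists c, (Num.sqrt c); split; rewrite ?sqrtr_gt0// => n w n4 wt w1.
have [i [j [ij H]]] := exists_pair n4 wt w1.
split; first by exists i, j; split => //; apply: H; rewrite mem_head.
have disc_ge k l : c * n%:R ^+ 3 <= disc_plus (w k) (w l) * disc_minus (w k) (w l) ->
    Num.sqrt c * (n%:R `^ (3 / 2)) <= disc (w k) (w l).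
  (* One value of the gain lies between the extremes, so the two discrepancies have nonnegative sum
     and their maximum [D] is nonnegative; then D^2 dominates their product. *)
  have /andP[h1 h2] := gain_bounds (w l) (1%g, 1%g) (wt k).
  move=> h; set D := disc _ _.
  have Dp : disc_plus (w k) (w l) <= D by rewrite /D /disc le_max lexx.
  have Dm : disc_minus (w k) (w l) <= D by rewrite /D /disc le_max lexx orbT.
  have D0 : 0 <= D by lra.
  rewrite -(@ler_pXn2r _ 2) ?nnegrE ?mulr_ge0 ?sqrtr_ge0 ?powR_ge0//.
  rewrite exprMn sqr_sqrtr ?(ltW c0)// -(powR_mulrn 2) ?powR_ge0// -powRrM.
  have -> : 3 / 2 * 2%:R = 3%:R :> R by field.
  rewrite powR_mulrn ?ler0n//; apply: (le_trans h); rewrite expr2.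
  have [m0|m0] := lerP 0 (disc_minus (w k) (w l)); last first.
    by rewrite (le_trans (mulr_ge0_le0 _ (ltW m0)))// ?mulr_ge0//; lra.
  by rewrite (le_trans (ler_wpM2r m0 Dp))// ler_wpM2l.
have [lt_ij|le_ji] := ltnP i j.
  by exists i, j; split => //; apply: disc_ge; apply: H; rewrite mem_head.
exists j, i; split; first by rewrite ltn_neqAle eq_sym ij.
by apply: disc_ge; apply: H; rewrite !inE eqxx orbT.
Qed.
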